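(* Let $f:G\to G'$ be an arbitrary homomorphism between finite groups. Then: (1) $\to_{\mathbb{L}\mathrm{res}_f\mathscr{O}'} \;=\; f^{-1}_L(\to_{\mathscr{O}'})$ for every marked $G'$-operad $\mathscr{O}'$; (2) $\to_{\mathbb{R}\mathrm{coind}_f\mathscr{O}} \;=\; f_R(\to_{\mathscr{O}})$ for every marked $G$-operad $\mathscr{O}$; (3) if $f$ is injective, then $\to_{\mathbb{L}\mathrm{ind}_f\mathscr{O}} \;=\; f_L(\to_{\mathscr{O}})$ for every marked $G$-operad $\mathscr{O}$.
   Context: For a finite group $G$, $\mathbf{Op}^G$ is the category of symmetric operads in left $G$-sets, and $\mathscr{O}(n)$ is regarded as a left $G\times\Sigma_n$-set via $(g,\sigma)\cdot x=gx\sigma^{-1}$. A marked $G$-operad is an operad $\mathscr{O}\in\mathbf{Op}^G$ with chosen elements $u\in\mathscr{O}(0)^G$ and $p\in\mathscr{O}(2)^G$; morphisms preserve the markings. The category of these is $\mathbf{Op}^G_+$. Let $\mathbf{Sym}^G$ be the category of symmetric sequences in left $G$-sets and $F_+:\mathbf{Sym}^G\to\mathbf{Op}^G_+$ the left adjoint of the forgetful functor. A graph subgroup of $G\times\Sigma_n$ is a subgroup $\{(h,\sigma(h))\mid h\in H\}$ with $H\subset G$ a subgroup and $\sigma:H\to\Sigma_n$ a homomorphism. The category $\mathbf{Op}^G_+$ has a model structure in which a morphism $\varphi:\mathscr{O}\to\mathscr{P}$ is a weak equivalence iff for every $n\ge0$ and graph subgroup $\Gamma\subset G\times\Sigma_n$,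 $\mathscr{P}(n)^\Gamma\ne\varnothing$ implies $\mathscr{O}(n)^\Gamma\ne\varnothing$; the generating cofibrations are the maps $F_+(\varnothing\to(G\times\Sigma_n)/\Gamma)$ and the generating acyclic cofibrations are $F_+$ of the inclusions $(G\times\Sigma_n)/\Gamma\to(G\times\Sigma_n)/\Gamma\sqcup(G\times\Sigma_n)/\Gamma$, for $n\ge0$ and graph subgroups $\Gamma\subset G\times\Sigma_n$ (each orbit being a symmetric sequence concentrated in arity $n$). Every object is fibrant. Writing $BG$ for the one-object category with morphisms $G$ and $\mathbf{Op}_+$ for marked operads in sets, $\mathbf{Op}^G_+\cong\mathrm{Fun}(BG,\mathbf{Op}_+)$. For $f:G\to G'$, $\mathrm{res}_f:\mathbf{Op}^{G'}_+\to\mathbf{Op}^G_+$ is pullback along $Bf$, and $\mathrm{ind}_f$, $\mathrm{coind}_f:\mathbf{Op}^G_+\to\mathbf{Op}^{G'}_+$ are left and right Kan extension along $Bf$. The pair $\mathrm{res}_f\dashv\mathrm{coind}_f$ is a Quillen adjunction for every $f$, and $\mathrm{ind}_f\dashv\mathrm{res}_f$ is a Quillen adjunction when $f$ is injective; $\mathbb{L}$ and $\mathbb{R}$ denote left and right derived functors (computed by cofibrant, respectively fibrant, replacement). For a subgroup pair $K\subset H\subset G$, let $\Gamma(H/K)\subset G\times\Sigma_{|H:K|}$ be the graph of a chosen permutation representation $H\to\Sigma_{|H:K|}$ of the orbit $H/K$. For $\mathscr{O}\in\mathbf{Op}^G_+$, define a relation on the set $\mathbf{Sub}(G)$ of subgroups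 of $G$ by: $K\to_{\mathscr{O}}H$ iff $K\subset H$ and $\mathscr{O}(|H:K|)^{\Gamma(H/K)}\ne\varnothing$. It is a $G$-transfer system and depends only on the weak equivalence class of $\mathscr{O}$. A $G$-transfer system is a partial order $\to$ on $\mathbf{Sub}(G)$ such that $K\to H$ implies $K\subset H$, $gKg^{-1}\to gHg^{-1}$ for all $g\in G$, and $L\cap K\to L$ for all subgroups $L\subset H$. Relations are identified with sets of pairs. For a $G$-transfer system $\to$ and a $G'$-transfer system $\rightsquigarrow$: $f_L(\to)$ is the least $G'$-transfer system containing $\{(f(K),f(H))\mid K\to H\}$; $f^{-1}_L(\rightsquigarrow)$ is the least $G$-transfer system containing $\{(f^{-1}K',f^{-1}H')\mid K'\rightsquigarrow H'\}$; and $f_R(\to)$ is the largest $G'$-transfer system contained in the partial order $\{(K',H')\mid K'\subset H'\subset G',\ f^{-1}K'\to f^{-1}H'\}$. *)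

(* Defs.v *)
(* MathComp, with the classical axioms of mathcomp.classical.boolp. *)
From HB Require Import structures.
From mathcomp Require Import all_boot all_order all_fingroup.
From mathcomp Require Import boolp.

Set Implicit Arguments.
Unset Strict Implicit.
Unset Printing Implicit Defensive.

Set Warnings "-redundant-canonical-projection".

Local Open Scope group_scope.

Implicit Types gT : finGroupType.

(* The product of 'S_n composes from left to right; Sigma n is the opposite
   group, in which (s * t) i = s (t i). *)
Definition Sigma (n : nat) : Type := 'S_n.

HB.instance Definition _ n := Finite.copy (Sigma n) {perm 'I_n}.

Section SigmaGroup.
Variable n : nat.
Definition sigma_mul (s t : Sigma n) : Sigma n := ((t : 'S_n) * (s : 'S_n)).
Definition sigma_one : Sigma n := (1 : 'S_n).
Definition sigma_inv (s : Sigma n) : Sigma n := (s : 'S_n)^-1.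
Lemma sigma_mulA : associative sigma_mul.
Proof. by move=> a b c; rewrite /sigma_mul mulgA. Qed.
Lemma sigma_mul1 : left_id sigma_one sigma_mul.
Proof. by move=> a; rewrite /sigma_mul mulg1. Qed.
Lemma sigma_mulV : left_inverse sigma_one sigma_inv sigma_mul.
Proof. by move=> a; rewrite /sigma_mul mulgV. Qed.
End SigmaGroup.

HB.instance Definition _ n := Finite_isGroup.Build (Sigma n)
  (@sigma_mulA n) (@sigma_mul1 n) (@sigma_mulV n).

Definition sigma_app n (s : Sigma n) : 'I_n -> 'I_n := fun i => (s : 'S_n) i.
Coercion sigma_app : Sigma >-> Funclass.

Definition sigma_perm n (h : 'I_n -> 'I_n) (h_inj : injective h) : Sigma n :=
  perm h_inj.

Lemma sigmaM n (s t : Sigma n) i : (s * t) i = s (t i).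
Proof. exact: permM. Qed.

Lemma sigma_inj n (s : Sigma n) : injective s.
Proof. exact: perm_inj. Qed.

Lemma sigma_permE n h (h_inj : injective h) (i : 'I_n) : sigma_perm h_inj i = h i.
Proof. exact: permE. Qed.

(* tagnat.Rank i l is the l-th position of the i-th block of 'I_(\sum_i j i). *)

Lemma eq_tagged_ord k (p : 'I_k -> nat) (t t' : {i & 'I_(p i)}) :
  tag t = tag t' -> tagged t = tagged t' :> nat -> t = t'.
Proof.
case: t t' => i l [i' l'] /= e.
by case: _ / e l' => l' e; congr existT; apply: val_inj.
Qed.

Lemma sum_perm k (s : Sigma k) (j : 'I_k -> nat) :
  (\sum_i j i = \sum_i j (s i))%N.
Proof. exact: (reindex_inj (@perm_inj _ (s : 'S_k))). Qed.

Definition block_perm_fun k (s : Sigma k) (j : 'I_k -> nat)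
    (x : 'I_(\sum_i j i)) : 'I_(\sum_i j i) :=
  let t := tagnat.sig (cast_ord (sum_perm s j) x) in
  tagnat.Rank (s (tag t)) (tagged t).

Lemma block_perm_inj k (s : Sigma k) j : injective (@block_perm_fun k s j).
Proof.
move=> x y /(congr1 val) /eqP; rewrite /block_perm_fun tagnat.eq_Rank.
move=> /andP[/eqP/sigma_inj e /eqP e2].
exact/(@cast_ord_inj _ _ (sum_perm s j))/tagnat.sig_inj/eq_tagged_ord.
Qed.

(* s(j_{s 1}, .., j_{s k}): the k blocks, of sizes j (s i), are permuted as s
   permutes k letters; block i of the source goes to block s i of the target. *)
Definition block_perm k (s : Sigma k) (j : 'I_k -> nat) : Sigma (\sum_i j i) :=
  sigma_perm (@block_perm_inj k s j).

Definition block_sum_fun k (j : 'I_k -> nat) (t : forall i, Sigma (j i))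
    (x : 'I_(\sum_i j i)) : 'I_(\sum_i j i) :=
  tagnat.Rank (tagnat.sig1 x) (t (tagnat.sig1 x) (tagnat.sig2 x)).

Lemma block_sum_inj k j t : injective (@block_sum_fun k j t).
Proof.
move=> x y /(congr1 val) /eqP; rewrite /block_sum_fun tagnat.eq_Rank.
rewrite /tagnat.sig2 /tagnat.sig1 => /andP[/eqP e /eqP e2].
apply/tagnat.sig_inj/eq_tagged_ord => //.
move: (tagnat.sig x) (tagnat.sig y) e e2 => [i l] [i' l'] /= e.
by case: _ / e l' => l' /val_inj/sigma_inj ->.
Qed.

(* t_1 (+) ... (+) t_k *)
Definition block_sum k (j : 'I_k -> nat) (t : forall i, Sigma (j i)) :
    Sigma (\sum_i j i) :=
  sigma_perm (@block_sum_inj k j t).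

(* sact is the right action of Sigma_n. *)
Record symseq (gT : finGroupType) := SymSeq {
  arity :> nat -> Type;
  gact : forall n, gT -> arity n -> arity n;
  sact : forall n, arity n -> Sigma n -> arity n;
  gact1 : forall n (x : arity n), gact 1 x = x;
  gactM : forall n g h (x : arity n), gact (g * h) x = gact g (gact h x);
  sact1 : forall n (x : arity n), sact x 1 = x;
  sactM : forall n (x : arity n) s t, sact x (s * t) = sact (sact x s) t;
  gsactC : forall n g (x : arity n) s, gact g (sact x s) = sact (gact g x) s
}.

Record symhom gT (S T : symseq gT) := SymHom {
  symhom_fun :> forall n, S n -> T n;
  symhom_gact : forall n g (x : S n),
    symhom_fun (gact g x) = gact g (symhom_fun x);
  symhom_sact : forall n (x : S n) s,
    symhom_fun (sact x s) = sact (symhom_fun x) s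
}.

(* Operations whose arities are equal but not convertible are compared as
   elements of {n : nat & O n}. *)
Notation tagop O x := (existT (fun n : nat => arity O n) _ x).

Record operad (gT : finGroupType) := Operad {
  op_seq :> symseq gT;
  opid : op_seq 1%N;
  opcomp : forall k (j : 'I_k -> nat),
    op_seq k -> (forall i, op_seq (j i)) -> op_seq (\sum_i j i)%N;
  opcomp_idl : forall n (d : op_seq n),
    tagop op_seq (opcomp opid (fun _ : 'I_1 => d)) = tagop op_seq d;
  opcomp_idr : forall k (c : op_seq k),
    tagop op_seq (opcomp c (fun _ : 'I_k => opid)) = tagop op_seq c;
  opcompA : forall k (j : 'I_k -> nat) (c : op_seq k)
      (d : forall i, op_seq (j i))
      (r : 'I_(\sum_i j i) -> nat) (e : forall x, op_seq (r x)),
    tagop op_seq (opcomp (opcomp c d) e) =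
    tagop op_seq (opcomp c
      (fun i => opcomp (d i) (fun l => e (tagnat.Rank i l))));
  (* (c s)(d_{s 1}, .., d_{s k}) = c(d_1, .., d_k) s(j_{s 1}, .., j_{s k}) *)
  opcomp_perm : forall k (j : 'I_k -> nat) (c : op_seq k)
      (d : forall i, op_seq (j i)) (s : Sigma k),
    tagop op_seq (opcomp (sact c s) (fun i => d (s i))) =
    tagop op_seq (sact (opcomp c d) (block_perm s j));
  opcomp_sum : forall k (j : 'I_k -> nat) (c : op_seq k)
      (d : forall i, op_seq (j i)) (t : forall i, Sigma (j i)),
    opcomp c (fun i => sact (d i) (t i)) = sact (opcomp c d) (block_sum t);
  gact_opid : forall g, gact g opid = opid;
  gact_opcomp : forall g k (j : 'I_k -> nat) (c : op_seq k)
      (d : forall i, op_seq (j i)),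
    gact g (opcomp c d) = opcomp (gact g c) (fun i => gact g (d i))
}.

Record moperad (gT : finGroupType) := MOperad {
  mop_op :> operad gT;
  mark0 : mop_op 0%N;
  mark2 : mop_op 2%N;
  gact_mark0 : forall g, gact g mark0 = mark0;
  gact_mark2 : forall g, gact g mark2 = mark2
}.

Record mophom gT (O P : moperad gT) := MOpHom {
  mophom_sym :> symhom O P;
  mophom_id : mophom_sym 1%N (opid O) = opid P;
  mophom_comp : forall k (j : 'I_k -> nat) (c : O k) (d : forall i, O (j i)),
    mophom_sym _ (opcomp c d) =
    opcomp (mophom_sym _ c) (fun i => mophom_sym _ (d i));
  mophom_mark0 : mophom_sym 0%N (mark0 O) = mark0 P;
  mophom_mark2 : mophom_sym 2%N (mark2 O) = mark2 P
}.

Definition graph gT n (H : {group gT}) (s : gT -> Sigma n) :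
    {set gT * Sigma n} :=
  [set (h, s h) | h in H].

Definition graph_subgroup gT n (Gam : {set gT * Sigma n}) : Prop :=
  exists (H : {group gT}) (s : {morphism H >-> Sigma n}), Gam = graph H s.

(* The left action (g, s) x = g x s^-1 of G x Sigma_n *)
Definition gsact gT (S : symseq gT) n (a : gT * Sigma n) (x : S n) : S n :=
  gact a.1 (sact x a.2^-1).

Definition fixed gT (S : symseq gT) n (Gam : {set gT * Sigma n}) (x : S n) :=
  forall a, a \in Gam -> gsact a x = x.

Definition has_fixed gT (S : symseq gT) n (Gam : {set gT * Sigma n}) : Prop :=
  exists x : S n, fixed Gam x.

Section Orbit.
Variables (gT : finGroupType) (n : nat) (Gam : {set gT * Sigma n}).

Definition cosets := {C | C \in lcosets Gam [set: gT * Sigma n]}.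

Lemma cosets_subproof a (C : cosets) :
  a *: val C \in lcosets Gam [set: gT * Sigma n].
Proof.
case: C => C /= /lcosetsP[b _ ->]; apply/lcosetsP.
by exists (a * b); rewrite ?inE ?lcosetM.
Qed.
Definition cosets_act a (C : cosets) : cosets :=
  exist _ (a *: val C) (cosets_subproof a C).

Lemma cosets_act1 C : cosets_act 1 C = C.
Proof. by apply: val_inj; rewrite /= lcoset1. Qed.
Lemma cosets_actM a b C : cosets_act (a * b) C = cosets_act a (cosets_act b C).
Proof. by apply: val_inj; rewrite /= lcosetM. Qed.

(* The orbit (G x Sigma_n) / Gam, concentrated in arity n *)
Inductive orbit_at : nat -> Type := OrbitAt of cosets : orbit_at n.

Definition orbit_gact m (g : gT) (x : orbit_at m) : orbit_at m :=
  let: OrbitAt C in orbit_at m := x return orbit_at m in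
  OrbitAt (cosets_act (g, 1) C).
Definition orbit_sact m (x : orbit_at m) : Sigma m -> orbit_at m :=
  let: OrbitAt C in orbit_at m := x return Sigma m -> orbit_at m in
  fun s => OrbitAt (cosets_act (1, s^-1) C).

Fact orbit_gact1 m (x : orbit_at m) : orbit_gact 1 x = x.
Proof. by case: x => C /=; rewrite cosets_act1. Qed.
Fact orbit_gactM m g h (x : orbit_at m) :
  orbit_gact (g * h) x = orbit_gact g (orbit_gact h x).
Proof.
case: x => C /=; congr OrbitAt; rewrite -cosets_actM; congr cosets_act.
by congr pair; rewrite mulg1.
Qed.
Fact orbit_sact1 m (x : orbit_at m) : orbit_sact x 1 = x.
Proof. by case: x => C /=; rewrite invg1 cosets_act1. Qed.
Fact orbit_sactM m (x : orbit_at m) s t :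
  orbit_sact x (s * t) = orbit_sact (orbit_sact x s) t.
Proof.
case: x s t => C s t /=; congr OrbitAt; rewrite -cosets_actM; congr cosets_act.
by congr pair; rewrite ?mulg1 // invMg.
Qed.
Fact orbit_gsactC m g (x : orbit_at m) s :
  orbit_gact g (orbit_sact x s) = orbit_sact (orbit_gact g x) s.
Proof.
case: x s => C s /=; congr OrbitAt; rewrite -!cosets_actM; congr cosets_act.
by congr pair; rewrite ?mulg1 ?mul1g.
Qed.

Definition orbit_seq : symseq gT :=
  SymSeq orbit_gact1 orbit_gactM orbit_sact1 orbit_sactM orbit_gsactC.
End Orbit.

Definition empty_seq (gT : finGroupType) : symseq gT.
Proof.
by apply: (@SymSeq gT (fun=> void) (fun _ _ x => x) (fun _ x _ => x)).
Defined.

Definition coprod_seq gT (S T : symseq gT) : symseq gT.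
Proof.
apply: (@SymSeq gT (fun n => (S n + T n)%type)
  (fun n g x => match x with inl y => inl (gact g y) | inr y => inr (gact g y) end)
  (fun n x s => match x with inl y => inl (sact y s) | inr y => inr (sact y s) end)).
- by move=> n [] x; rewrite gact1.
- by move=> n g h [] x; rewrite gactM.
- by move=> n [] x; rewrite sact1.
- by move=> n [] x s t; rewrite sactM.
- by move=> n g [] x s; rewrite gsactC.
Defined.

Definition from_empty gT (S : symseq gT) : symhom (empty_seq gT) S.
Proof.
apply: (@SymHom _ (empty_seq gT) S (fun n => @of_void (S n))).
- by move=> n g [].
- by move=> n [].
Defined.

Definition coprod_inl gT (S T : symseq gT) : symhom S (coprod_seq S T).
Proof. exact: (@SymHom _ S (coprod_seq S T) (fun n x => inl x)). Defined.

(* A is the free marked operad F_+(S), with unit eta. *)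
Definition is_free gT (S : symseq gT) (A : moperad gT) (eta : symhom S A) :=
  forall (B : moperad gT) (h : symhom S B),
    exists k : mophom A B,
      (forall n (x : S n), k n (eta n x) = h n x) /\
      forall k' : mophom A B, (forall n (x : S n), k' n (eta n x) = h n x) ->
        forall n (a : A n), k' n a = k n a.

(* phi is F_+(i) *)
Definition is_free_map gT (S T : symseq gT) (i : symhom S T)
    (A B : moperad gT) (phi : mophom A B) : Prop :=
  exists (etaS : symhom S A) (etaT : symhom T B),
    [/\ is_free etaS, is_free etaT &
        forall n (x : S n), phi n (etaS n x) = etaT n (i n x)].

Definition gen_cof gT (A B : moperad gT) (phi : mophom A B) : Prop :=
  exists n (Gam : {set gT * Sigma n}),
    graph_subgroup Gam /\ is_free_map (from_empty (orbit_seq Gam)) phi.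

Definition gen_acyc_cof gT (A B : moperad gT) (phi : mophom A B) : Prop :=
  exists n (Gam : {set gT * Sigma n}),
    graph_subgroup Gam /\
    is_free_map (coprod_inl (orbit_seq Gam) (orbit_seq Gam)) phi.

Definition weak_equiv gT (O P : moperad gT) (phi : mophom O P) : Prop :=
  forall n (Gam : {set gT * Sigma n}), graph_subgroup Gam ->
    has_fixed P Gam -> has_fixed O Gam.

Definition lifts gT (A B X Y : moperad gT)
    (i : mophom A B) (p : mophom X Y) : Prop :=
  forall (a : mophom A X) (b : mophom B Y),
    (forall n (x : A n), p n (a n x) = b n (i n x)) ->
    exists l : mophom B X,
      (forall n (x : A n), l n (i n x) = a n x) /\
      (forall n (x : B n), p n (l n x) = b n x).

Definition fibration gT (X Y : moperad gT) (p : mophom X Y) : Prop :=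
  forall (A B : moperad gT) (i : mophom A B), gen_acyc_cof i -> lifts i p.

(* In a cofibrantly generated model structure the acyclic fibrations are the
   maps with the right lifting property against the generating cofibrations,
   and the cofibrations are the maps with the left lifting property against
   all acyclic fibrations. *)
Definition acyc_fibration gT (X Y : moperad gT) (p : mophom X Y) : Prop :=
  forall (A B : moperad gT) (i : mophom A B), gen_cof i -> lifts i p.

Definition cofibration gT (A B : moperad gT) (i : mophom A B) : Prop :=
  forall (X Y : moperad gT) (p : mophom X Y), acyc_fibration p -> lifts i p.

Definition is_initial gT (A : moperad gT) : Prop :=
  forall B : moperad gT, exists k : mophom A B,
    forall (k' : mophom A B) n (x : A n), k' n x = k n x.

Definition is_terminal gT (A : moperad gT) : Prop :=
  forall B : moperad gT, exists k : mophom B A,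
    forall (k' : mophom B A) n (x : B n), k' n x = k n x.

Definition cofibrant gT (O : moperad gT) : Prop :=
  exists (A : moperad gT) (i : mophom A O), is_initial A /\ cofibration i.

Definition fibrant gT (O : moperad gT) : Prop :=
  exists (A : moperad gT) (p : mophom O A), is_terminal A /\ fibration p.

Definition cofibrant_replacement gT (O Q : moperad gT) (q : mophom Q O) : Prop :=
  cofibrant Q /\ weak_equiv q.

Definition fibrant_replacement gT (O R : moperad gT) (r : mophom O R) : Prop :=
  fibrant R /\ weak_equiv r.

Section Restriction.
Variables (gT gT' : finGroupType) (f : {morphism [set: gT] >-> gT'}).

Definition res_seq (S : symseq gT') : symseq gT.
Proof.
apply: (@SymSeq gT S (fun n g x => gact (f g) x) (@sact _ S)).
- by move=> n x; rewrite morph1 gact1.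
- by move=> n g h x; rewrite morphM ?inE // gactM.
- exact: sact1.
- exact: sactM.
- by move=> n g x s; apply: gsactC.
Defined.

Definition res_op (O : operad gT') : operad gT.
Proof.
apply: (@Operad gT (res_seq O) (opid O) (@opcomp _ O)).
- exact: opcomp_idl.
- exact: opcomp_idr.
- exact: opcompA.
- exact: opcomp_perm.
- exact: opcomp_sum.
- by move=> g; apply: gact_opid.
- by move=> g k j c d; apply: gact_opcomp.
Defined.

Definition res (O : moperad gT') : moperad gT.
Proof.
apply: (@MOperad gT (res_op O) (mark0 O) (mark2 O)).
- by move=> g; apply: gact_mark0.
- by move=> g; apply: gact_mark2.
Defined.

Definition res_symhom (S T : symseq gT') (h : symhom S T) :
  symhom (res_seq S) (res_seq T).
Proof.
apply: (@SymHom gT (res_seq S) (res_seq T) h).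
- by move=> n g x; exact: (@symhom_gact _ _ _ h n (f g) x).
- exact: (@symhom_sact _ _ _ h).
Defined.

Definition res_hom (O P : moperad gT') (h : mophom O P) :
  mophom (res O) (res P).
Proof.
apply: (@MOpHom gT (res O) (res P) (res_symhom h)).
- exact: (@mophom_id _ _ _ h).
- exact: (@mophom_comp _ _ _ h).
- exact: (@mophom_mark0 _ _ _ h).
- exact: (@mophom_mark2 _ _ _ h).
Defined.

(* (P, eta) is the left Kan extension of O along Bf. *)
Definition is_ind (O : moperad gT) (P : moperad gT') (eta : mophom O (res P)) :=
  forall (R : moperad gT') (h : mophom O (res R)),
    exists k : mophom P R,
      (forall n (x : O n), res_hom k n (eta n x) = h n x) /\
      forall k' : mophom P R,
        (forall n (x : O n), res_hom k' n (eta n x) = h n x) ->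
        forall n (y : P n), k' n y = k n y.

(* (P, eps) is the right Kan extension of O along Bf. *)
Definition is_coind (O : moperad gT) (P : moperad gT') (eps : mophom (res P) O) :=
  forall (R : moperad gT') (h : mophom (res R) O),
    exists k : mophom R P,
      (forall n (x : res R n), eps n (res_hom k n x) = h n x) /\
      forall k' : mophom R P,
        (forall n (x : res R n), eps n (res_hom k' n x) = h n x) ->
        forall n (y : R n), k' n y = k n y.

(* Derived functors are determined only up to weak equivalence: these are the
   predicates "P is a value of the derived functor at O". *)

Definition is_Lres (O : moperad gT') (P : moperad gT) : Prop :=
  exists (Q : moperad gT') (q : mophom Q O),
    cofibrant_replacement q /\ P = res Q.

Definition is_Lind (O : moperad gT) (P : moperad gT') : Prop :=
  exists (Q : moperad gT) (q : mophom Q O) (eta : mophom Q (res P)),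
    cofibrant_replacement q /\ is_ind eta.

Definition is_Rcoind (O : moperad gT) (P : moperad gT') : Prop :=
  exists (R : moperad gT) (r : mophom O R) (eps : mophom (res P) R),
    fibrant_replacement r /\ is_coind eps.

End Restriction.

Section CosetPerm.
Variables (gT : finGroupType) (K H : {group gT}).

Definition nth_coset (i : nat) : {set gT} := nth set0 (enum (lcosets K H)) i.

(* The permutation representation H -> Sigma_|H:K| of H / K, for the
   enumeration nth_coset of the left cosets; see coset_permP. *)
Definition coset_perm (h : gT) : Sigma #|H : K| :=
  odflt 1 [pick s : Sigma #|H : K| |
    [forall i, nth_coset (s i) == h *: nth_coset i]].

Definition coset_graph : {set gT * Sigma #|H : K|} := graph H coset_perm.

Lemma coset_permP h : h \in H ->
  forall i, nth_coset (coset_perm h i) = h *: nth_coset i.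
Proof.
move=> Hh; rewrite /coset_perm; case: pickP => [s /forallP sP i|no].
  exact/eqP.
have szE : size (enum (lcosets K H)) = #|H : K|.
  by rewrite -cardE card_lcosets.
have nth_in (i : 'I_#|H : K|) : nth_coset i \in lcosets K H.
  by rewrite -mem_enum mem_nth // szE.
have mul_in (i : 'I_#|H : K|) : h *: nth_coset i \in lcosets K H.
  case/lcosetsP: (nth_in i) => x Hx ->; apply/lcosetsP.
  by exists (h * x); rewrite ?groupM // lcosetM.
have lt_ix (i : 'I_#|H : K|) :
    (index (h *: nth_coset i) (enum (lcosets K H)) < #|H : K|)%N.
  by rewrite -[ltnRHS]szE index_mem mem_enum.
pose F (i : 'I_#|H : K|) : 'I_#|H : K| := Ordinal (lt_ix i).
have FE i : nth_coset (F i) = h *: nth_coset i.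
  by rewrite /nth_coset /= nth_index // mem_enum.
have F_inj : injective F.
  move=> i i' /(congr1 (fun x : 'I__ => nth_coset x)); rewrite !FE => /lcoset_inj /eqP.
  by rewrite nth_uniq ?szE ?enum_uniq // => /eqP/val_inj.
have /negP[] := no (sigma_perm F_inj).
by apply/forallP => i; rewrite sigma_permE FE.
Qed.

Lemma coset_permM : {in H &, {morph coset_perm : x y / x * y >-> x * y}}.
Proof.
move=> x y Hx Hy.
suff E i : coset_perm (x * y) i = (coset_perm x * coset_perm y) i.
  by apply/permP => i; exact: E.
have szE : size (enum (lcosets K H)) = #|H : K|.
  by rewrite -cardE card_lcosets.
apply/val_inj/eqP.
have lt_sz (m : 'I_#|H : K|) : (m < size (enum (lcosets K H)))%N.
  by rewrite [ltnRHS]szE.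
rewrite -(nth_uniq set0 (lt_sz _) (lt_sz _) (enum_uniq (lcosets K H))).
by rewrite -!/(nth_coset _) sigmaM !coset_permP ?groupM // lcosetM.
Qed.

Lemma coset_graph_subgroup : graph_subgroup coset_graph.
Proof. by exists H, (Morphism coset_permM). Qed.
End CosetPerm.

(* K ->_O H *)
Definition transfer gT (O : moperad gT) (K H : {group gT}) : Prop :=
  K \subset H /\ has_fixed O (coset_graph K H).

Definition subrel_on gT (R S : {group gT} -> {group gT} -> Prop) : Prop :=
  forall K H, R K H -> S K H.

Record transfer_system gT (R : {group gT} -> {group gT} -> Prop) : Prop :=
  TransferSystem {
    ts_refl : forall K, R K K;
    ts_anti : forall K H, R K H -> R H K -> K = H;
    ts_trans : forall L K H, R L K -> R K H -> R L H;
    ts_sub : forall K H, R K H -> K \subset H;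
    (* g K g^-1 is K :^ g^-1 *)
    ts_conj : forall g K H, R K H -> R (K :^ g^-1)%G (H :^ g^-1)%G;
    ts_restr : forall K H L : {group gT}, R K H -> L \subset H -> R (L :&: K)%G L
  }.

Definition is_least_ts gT (X T : {group gT} -> {group gT} -> Prop) : Prop :=
  [/\ transfer_system T, subrel_on X T &
      forall T', transfer_system T' -> subrel_on X T' -> subrel_on T T'].

Definition is_largest_ts gT (X T : {group gT} -> {group gT} -> Prop) : Prop :=
  [/\ transfer_system T, subrel_on T X &
      forall T', transfer_system T' -> subrel_on T' X -> subrel_on T' T].

Section FunctorialityOfTransferSystems.
Variables (gT gT' : finGroupType) (f : {morphism [set: gT] >-> gT'}).

Definition image_rel (R : {group gT} -> {group gT} -> Prop) :
    {group gT'} -> {group gT'} -> Prop :=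
  fun A B => exists K H, [/\ R K H, A = (f @* K)%G & B = (f @* H)%G].

Definition preimage_rel (R : {group gT'} -> {group gT'} -> Prop) :
    {group gT} -> {group gT} -> Prop :=
  fun A B => exists K H, [/\ R K H, A = (f @*^-1 K)%G & B = (f @*^-1 H)%G].

Definition pullback_rel (R : {group gT} -> {group gT} -> Prop) :
    {group gT'} -> {group gT'} -> Prop :=
  fun K H => K \subset H /\ R (f @*^-1 K)%G (f @*^-1 H)%G.

(* T = f_L(R), T = f^{-1}_L(R) and T = f_R(R) *)
Definition is_fL R T : Prop := is_least_ts (image_rel R) T.
Definition is_finvL R T : Prop := is_least_ts (preimage_rel R) T.
Definition is_fR R T : Prop := is_largest_ts (pullback_rel R) T.
End FunctorialityOfTransferSystems.

(* The universal objects and replacements quantified over above all exist; see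
   Lres_exists, Lind_exists and Rcoind_exists at the end of the file. *)

Lemma tagop_inj gT (S : symseq gT) n (x y : S n) : tagop S x = tagop S y -> x = y.
Proof. exact: existT_inj2. Qed.

Lemma sum_blocks k (j : 'I_k -> nat) (r : 'I_(\sum_i j i) -> nat) :
  (\sum_x r x = \sum_i \sum_l r (tagnat.Rank i l))%N.
Proof.
rewrite (reindex _ (@tagnat.rank_bij_on _ _)) /= sig_big_dep /=.
by apply: eq_bigr => -[i l] _; rewrite tagnat.rankE.
Qed.

(* A marked operad presented by generators X; V selects the assignments of the
   generators that are required to extend to morphisms, so that two terms are
   identified when all these assignments agree on them. *)
Section Presentation.
Variables (gT : finGroupType) (X : nat -> Type).
Variable V : forall B : moperad gT, (forall n, X n -> B n) -> Prop.

Inductive term : nat -> Type :=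
| TGen n of X n : term n
| TId : term 1
| TMark0 : term 0
| TMark2 : term 2
| TG n of gT & term n : term n
| TS n of term n & Sigma n : term n
| TComp k (j : 'I_k -> nat) of term k & (forall i, term (j i)) : term (\sum_i j i).

Fixpoint teval (B : moperad gT) (h : forall n, X n -> B n) n (t : term n) : B n :=
  match t in term n return B n with
  | TGen n x => h n x
  | TId => opid B
  | TMark0 => mark0 B
  | TMark2 => mark2 B
  | TG n g t => gact g (teval h t)
  | TS n t s => sact (teval h t) s
  | TComp k j c d => opcomp (teval h c) (fun i => teval h (d i))
  end.

Definition teq n (t t' : term n) : Prop :=
  forall (B : moperad gT) (h : forall n, X n -> B n), V h -> teval h t = teval h t'.

Definition tquo n : Type := {P : term n -> Prop | exists t, P = teq t}.
Definition tcls n (t : term n) : tquo n := exist _ (teq t) (ex_intro _ t erefl).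
Definition trepr n (q : tquo n) : term n := projT1 (cid (projT2 q)).

Definition qeval (B : moperad gT) (h : forall n, X n -> B n) n (q : tquo n) : B n :=
  teval h (trepr q).

Lemma qevalE B h n (t : term n) : V h -> @qeval B h n (tcls t) = teval h t.
Proof.
move=> Vh; rewrite /qeval /trepr; case: cid => /= t' E.
have : teq t t by [].
by rewrite {1}E => ->.
Qed.

Lemma tcls_eq n (t t' : term n) : teq t t' -> tcls t = tcls t'.
Proof.
move=> E; apply: eq_exist; apply/funext => s; apply/propext.
by split=> H B h Vh; [rewrite -E // | rewrite E //]; apply: H.
Qed.

Lemma treprK n (q : tquo n) : tcls (trepr q) = q.
Proof.
rewrite /trepr; case: q => P HP; case: cid => t /= E.
by apply: eq_exist.
Qed.

Lemma qsep n (q q' : tquo n) :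
  (forall (B : moperad gT) (h : forall n, X n -> B n), V h ->
     qeval h q = qeval h q') ->
  q = q'.
Proof.
by move=> E; rewrite -(treprK q) -(treprK q'); apply: tcls_eq => B h /E.
Qed.

Lemma qsep_tag m n (q : tquo m) (q' : tquo n) : m = n ->
  (forall (B : moperad gT) (h : forall n, X n -> B n), V h ->
     tagop B (qeval h q) = tagop B (qeval h q')) ->
  existT tquo m q = existT tquo n q'.
Proof.
move=> e; case: _ / e q' => q' E; congr existT; apply: qsep => B h Vh.
exact/tagop_inj/E.
Qed.

Definition qgact n g (q : tquo n) : tquo n := tcls (TG g (trepr q)).
Definition qsact n (q : tquo n) s : tquo n := tcls (TS (trepr q) s).
Definition qcomp k (j : 'I_k -> nat) (c : tquo k) (d : forall i, tquo (j i)) :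
  tquo (\sum_i j i) := tcls (TComp (trepr c) (fun i => trepr (d i))).

Section Eval.
Variables (B : moperad gT) (h : forall n, X n -> B n).
Arguments h : clear implicits.
Hypothesis Vh : V h.
Lemma qeval_gen n (x : X n) : qeval h (tcls (TGen x)) = h n x.
Proof. by rewrite qevalE. Qed.
Lemma qeval_id : qeval h (tcls TId) = opid B.
Proof. by rewrite qevalE. Qed.
Lemma qeval_mark0 : qeval h (tcls TMark0) = mark0 B.
Proof. by rewrite qevalE. Qed.
Lemma qeval_mark2 : qeval h (tcls TMark2) = mark2 B.
Proof. by rewrite qevalE. Qed.
Lemma qeval_gact n g (q : tquo n) : qeval h (qgact g q) = gact g (qeval h q).
Proof. by rewrite qevalE. Qed.
Lemma qeval_sact n (q : tquo n) s : qeval h (qsact q s) = sact (qeval h q) s.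
Proof. by rewrite qevalE. Qed.
Lemma qeval_comp k (j : 'I_k -> nat) (c : tquo k) (d : forall i, tquo (j i)) :
  qeval h (qcomp c d) = opcomp (qeval h c) (fun i => qeval h (d i)).
Proof. by rewrite qevalE. Qed.
End Eval.

Lemma opcomp_ext (B : operad gT) k (j : 'I_k -> nat) (c : B k)
    (d d' : forall i, B (j i)) :
  (forall i, d i = d' i) -> opcomp c d = opcomp c d'.
Proof. by move=> E; congr opcomp; apply: functional_extensionality_dep. Qed.

Definition quo_seq : symseq gT.
Proof.
apply: (@SymSeq gT tquo qgact qsact).
- by move=> n q; apply: qsep => B h Vh; rewrite qeval_gact // gact1.
- by move=> n g g' q; apply: qsep => B h Vh; rewrite !qeval_gact // gactM.
- by move=> n q; apply: qsep => B h Vh; rewrite qeval_sact // sact1.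
- by move=> n q s t; apply: qsep => B h Vh; rewrite !qeval_sact // sactM.
- move=> n g q s; apply: qsep => B h Vh.
  by rewrite !(qeval_gact, qeval_sact) // gsactC.
Defined.

Definition quo_op : operad gT.
Proof.
apply: (@Operad gT quo_seq (tcls TId) qcomp).
- move=> n d; apply: qsep_tag; first by rewrite big_ord1.
  by move=> B h Vh; rewrite qeval_comp // qeval_id // opcomp_idl.
- move=> n c; apply: qsep_tag; first by rewrite sum1_card card_ord.
  move=> B h Vh; rewrite qeval_comp // -[in RHS]opcomp_idr; congr (tagop _ _).
  by apply: opcomp_ext => i; rewrite qeval_id.
- move=> k j c d r e; apply: qsep_tag; first exact: sum_blocks.
  move=> B h Vh; rewrite !qeval_comp // opcompA; congr (tagop _ _).
  by apply: opcomp_ext => i; rewrite qeval_comp.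
- move=> k j c d s; apply: qsep_tag; first by rewrite -sum_perm.
  move=> B h Vh; rewrite qeval_comp // !qeval_sact // qeval_comp //.
  by rewrite -opcomp_perm.
- move=> k j c d t; apply: qsep => B h Vh.
  rewrite qeval_comp // qeval_sact // qeval_comp // -opcomp_sum.
  by apply: opcomp_ext => i; rewrite qeval_sact.
- by move=> g; apply: qsep => B h Vh; rewrite qeval_gact // qeval_id // gact_opid.
- move=> g k j c d; apply: qsep => B h Vh.
  rewrite !(qeval_gact, qeval_comp) // gact_opcomp.
  by apply: opcomp_ext => i; rewrite qeval_gact.
Defined.

Definition quo : moperad gT.
Proof.
apply: (@MOperad gT quo_op (tcls TMark0) (tcls TMark2)).
- by move=> g; apply: qsep => B h Vh; rewrite qeval_gact // qeval_mark0 // gact_mark0.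
- by move=> g; apply: qsep => B h Vh; rewrite qeval_gact // qeval_mark2 // gact_mark2.
Defined.

Definition quo_gen n (x : X n) : quo n := tcls (TGen x).

Definition quo_ext (B : moperad gT) (h : forall n, X n -> B n) (Vh : V h) :
  mophom quo B.
Proof.
pose s : symhom quo B := @SymHom gT quo B (fun n q => qeval h q)
  (fun n g q => qeval_gact Vh g q) (fun n q t => qeval_sact Vh q t).
refine (@MOpHom gT quo B s _ _ _ _).
- exact: qeval_id.
- exact: (@qeval_comp _ _ Vh).
- exact: qeval_mark0.
- exact: qeval_mark2.
Defined.

Lemma quo_extE (B : moperad gT) (h : forall n, X n -> B n) (Vh : V h) n (x : X n) :
  quo_ext Vh n (quo_gen x) = h n x.
Proof. exact: qeval_gen. Qed.

Lemma quo_uniq (B : moperad gT) (k k' : mophom quo B) :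
  (forall n (x : X n), k n (quo_gen x) = k' n (quo_gen x)) ->
  forall n (q : quo n), k n q = k' n q.
Proof.
move=> E.
have tE n (t : term n) : k n (tcls t) = k' n (tcls t).
  elim: {n} t => [n x|||| n g t IH | n t IH s | m j c IHc d IHd].
  - exact: E.
  - by rewrite !mophom_id.
  - by rewrite !mophom_mark0.
  - by rewrite !mophom_mark2.
  - have -> : tcls (TG g t) = gact g (tcls t : quo n).
      by apply: qsep => C h Vh; rewrite qeval_gact // !qevalE.
    by rewrite !symhom_gact IH.
  - have -> : tcls (TS t s) = sact (tcls t : quo n) s.
      by apply: qsep => C h Vh; rewrite qeval_sact // !qevalE.
    by rewrite !symhom_sact IH.
  - have -> : tcls (TComp c d) =
        opcomp (tcls c : quo m) (fun i => (tcls (d i) : quo (j i))).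
      apply: qsep => C h Vh; rewrite qeval_comp // !qevalE //=.
      by apply: opcomp_ext => i; rewrite qevalE.
    by rewrite !mophom_comp IHc; apply: opcomp_ext.
by move=> n q; rewrite -(treprK q).
Qed.
End Presentation.

Theorem free_exists gT (S : symseq gT) :
  exists (A : moperad gT) (eta : symhom S A), is_free eta.
Proof.
pose V (B : moperad gT) (h : forall n, S n -> B n) :=
  exists phi : symhom S B, forall n x, h n x = phi n x.
have gE n g (x : S n) : @quo_gen _ _ V n (gact g x) = gact g (quo_gen V x).
  apply: qsep => B h Vh; rewrite qeval_gact // !qeval_gen //.
  by case: Vh => phi E; rewrite !E symhom_gact.
have sE n (x : S n) s : @quo_gen _ _ V n (sact x s) = sact (quo_gen V x) s.
  apply: qsep => B h Vh; rewrite qeval_sact // !qeval_gen //.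
  by case: Vh => phi E; rewrite !E symhom_sact.
exists (quo V), (@SymHom gT S (quo V) (@quo_gen _ _ V) gE sE) => B h.
have Vh : V B h by exists h.
exists (quo_ext Vh); split=> [n x|k' E]; first exact: quo_extE.
by apply: quo_uniq => n x; rewrite quo_extE; apply: E.
Qed.

Theorem initial_exists gT : exists A : moperad gT, is_initial A.
Proof.
have [A [eta A_free]] := free_exists (empty_seq gT).
exists A => B; have [k [_ k_uniq]] := A_free B (from_empty B).
by exists k => k' n x; apply: k_uniq => m [].
Qed.

Theorem ind_exists gT gT' (f : {morphism [set: gT] >-> gT'}) (O : moperad gT) :
  exists (P : moperad gT') (eta : mophom O (res f P)), is_ind eta.
Proof.
pose V (B : moperad gT') (h : forall n, O n -> B n) :=
  exists phi : mophom O (res f B), forall n x, h n x = phi n x.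
pose gen n (x : O n) : res f (quo V) n := quo_gen V x.
have gE n g (x : O n) : gen n (gact g x) = gact g (gen n x).
  apply: qsep => B h Vh; rewrite qeval_gact // !qeval_gen //.
  by case: Vh => phi E; rewrite !E symhom_gact.
have sE n (x : O n) s : gen n (sact x s) = sact (gen n x) s.
  apply: qsep => B h Vh; rewrite qeval_sact // !qeval_gen //.
  by case: Vh => phi E; rewrite !E symhom_sact.
have [eta etaE] : exists eta : mophom O (res f (quo V)), forall n x, eta n x = gen n x.
  unshelve eexists.
    refine (@MOpHom gT O (res f (quo V)) (@SymHom gT O (res f (quo V)) gen gE sE) _ _ _ _).
    - apply: qsep => B h Vh; rewrite qeval_gen // qeval_id //.
      by case: Vh => phi E; rewrite !E mophom_id.
    - move=> k j c d; apply: qsep => B h Vh.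
      rewrite qeval_gen // qeval_comp // qeval_gen //.
      case: (Vh) => phi E; rewrite E mophom_comp E.
      by apply: opcomp_ext => i; rewrite /= qeval_gen // E.
    - apply: qsep => B h Vh; rewrite qeval_gen // qeval_mark0 //.
      by case: Vh => phi E; rewrite !E mophom_mark0.
    - apply: qsep => B h Vh; rewrite qeval_gen // qeval_mark2 //.
      by case: Vh => phi E; rewrite !E mophom_mark2.
  by [].
exists (quo V), eta => R h.
have Vh : V R h by exists h.
exists (quo_ext Vh); split=> [n x|k' E].
  by rewrite etaE; exact: (quo_extE Vh x).
by apply: quo_uniq => n x; rewrite quo_extE -E etaE.
Qed.

Section CoinductionExists.
Variables (gT gT' : finGroupType) (f : {morphism [set: gT] >-> gT'}).
Variable O : moperad gT.

Definition coind_at n : Type :=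
  {x : gT' -> O n | forall g a, x (f g * a) = gact g (x a)}.

Lemma coind_ext n (x y : coind_at n) : (forall a, sval x a = sval y a) -> x = y.
Proof. by case: x y => x Hx [y Hy] /= E; apply: eq_exist; apply/funext. Qed.

Definition coind_const n (c : O n) (cP : forall g, gact g c = c) : coind_at n.
Proof. by exists (fun=> c) => g a; rewrite cP. Defined.

Definition coind_gact n (b : gT') (x : coind_at n) : coind_at n.
Proof. by exists (fun a => sval x (a * b)) => g a; rewrite -mulgA (svalP x). Defined.

Definition coind_sact n (x : coind_at n) (s : Sigma n) : coind_at n.
Proof.
by exists (fun a => sact (sval x a) s) => g a; rewrite (svalP x) gsactC.
Defined.

Definition coind_comp k (j : 'I_k -> nat) (c : coind_at k)
    (d : forall i, coind_at (j i)) : coind_at (\sum_i j i)%N.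
Proof.
exists (fun a => opcomp (sval c a) (fun i => sval (d i) a)) => g a.
rewrite (svalP c) gact_opcomp; apply: opcomp_ext => i; exact: (svalP (d i)).
Defined.

Lemma coind_ext_tag m n (x : coind_at m) (y : coind_at n) : m = n ->
  (forall a, tagop O (sval x a) = tagop O (sval y a)) ->
  existT coind_at m x = existT coind_at n y.
Proof.
move=> e; case: _ / e y => y E; congr existT; apply: coind_ext => a.
exact/tagop_inj/E.
Qed.

Definition coind_seq : symseq gT'.
Proof.
apply: (@SymSeq gT' coind_at coind_gact coind_sact).
- by move=> n x; apply: coind_ext => a /=; rewrite mulg1.
- by move=> n g h x; apply: coind_ext => a /=; rewrite mulgA.
- by move=> n x; apply: coind_ext => a /=; rewrite sact1.
- by move=> n x s t; apply: coind_ext => a /=; rewrite sactM.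
- by move=> n g x s; apply: coind_ext.
Defined.

Definition coind_op : operad gT'.
Proof.
apply: (@Operad gT' coind_seq (coind_const (@gact_opid _ O)) coind_comp).
- move=> n d; apply: coind_ext_tag; first by rewrite big_ord1.
  by move=> a; apply: opcomp_idl.
- move=> n c; apply: coind_ext_tag; first by rewrite sum1_card card_ord.
  by move=> a; apply: opcomp_idr.
- move=> k j c d r e; apply: coind_ext_tag; first exact: sum_blocks.
  by move=> a; apply: opcompA.
- move=> k j c d s; apply: coind_ext_tag; first by rewrite -sum_perm.
  by move=> a; apply: (opcomp_perm (sval c a) (fun i => sval (d i) a)).
- by move=> k j c d t; apply: coind_ext => a; apply: opcomp_sum.
- by move=> g; apply: coind_ext.
- by move=> g k j c d; apply: coind_ext.
Defined.

Definition coind : moperad gT'.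
Proof.
apply: (@MOperad gT' coind_op (coind_const (@gact_mark0 _ O))
  (coind_const (@gact_mark2 _ O))).
- by move=> g; apply: coind_ext.
- by move=> g; apply: coind_ext.
Defined.

Lemma coind_counit_gact n g (x : res f coind n) :
  sval (gact g x) 1 = gact g (sval x 1).
Proof. by rewrite /= -(svalP x) mul1g mulg1. Qed.

Definition coind_counit : mophom (res f coind) O.
Proof.
by unshelve refine (@MOpHom gT (res f coind) O
  (@SymHom gT (res f coind) O (fun n x => sval x 1) coind_counit_gact _)
  _ _ _ _).
Defined.

Theorem coind_exists :
  exists (P : moperad gT') (eps : mophom (res f P) O), is_coind eps.
Proof.
exists coind, coind_counit => R h.
have hP n (x : R n) g a :
    h n (gact (f g * a) x : res f R n) = gact g (h n (gact a x)).
  by rewrite -symhom_gact /= gactM.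
pose k0 n (x : R n) : coind n := exist _ _ (hP n x).
have [k kE] : exists k : mophom R coind, forall n x, k n x = k0 n x.
  unshelve eexists.
    unshelve refine (@MOpHom gT' R coind (@SymHom gT' R coind k0 _ _) _ _ _ _).
    - by move=> n g x; apply: coind_ext => a /=; rewrite gactM.
    - move=> n x s; apply: coind_ext => a /=; rewrite gsactC.
      exact: (@symhom_sact _ _ _ h).
    - apply: coind_ext => a /=; rewrite gact_opid; exact: (mophom_id h).
    - move=> m j c d; apply: coind_ext => a /=; rewrite gact_opcomp.
      exact: (@mophom_comp _ _ _ h m j (gact a c) (fun i => gact a (d i))).
    - apply: coind_ext => a /=; rewrite gact_mark0; exact: (mophom_mark0 h).
    - apply: coind_ext => a /=; rewrite gact_mark2; exact: (mophom_mark2 h).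
  by [].
exists k; split=> [n x|k' E n y].
  change (sval (k n (x : R n)) 1 = h n x); rewrite kE.
  by change (h n (gact 1 (x : R n) : R n) = h n x); rewrite gact1.
apply: coind_ext => a; rewrite kE.
change (sval (k' n y) a = h n (gact a y : R n)); rewrite -E.
change (sval (k' n y) a = sval (k' n (gact a y)) 1).
by rewrite symhom_gact /= mul1g.
Qed.
End CoinductionExists.

Section CofibrantReplacementExists.
Variable gT : finGroupType.

Definition comp_symhom (S T U : symseq gT) (p : symhom T U) (q : symhom S T) :
  symhom S U.
Proof.
apply: (@SymHom gT S U (fun n x => p n (q n x))).
- by move=> n g x; rewrite !symhom_gact.
- by move=> n x s; rewrite !symhom_sact.
Defined.

Definition comp_mophom (A B C : moperad gT) (p : mophom B C) (q : mophom A B) :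
  mophom A C.
Proof.
refine (@MOpHom gT A C (comp_symhom p q) _ _ _ _) => /=.
- by rewrite !mophom_id.
- by move=> k j c d; rewrite !mophom_comp.
- by rewrite !mophom_mark0.
- by rewrite !mophom_mark2.
Defined.

Lemma free_uniq (S : symseq gT) (A : moperad gT) (eta : symhom S A) :
  is_free eta -> forall (B : moperad gT) (k k' : mophom A B),
  (forall n (x : S n), k n (eta n x) = k' n (eta n x)) ->
  forall n (a : A n), k n a = k' n a.
Proof.
move=> A_free B k k' E n a.
have [k1 [_ k1P]] := A_free B (comp_symhom k' eta).
by rewrite (k1P k') // (k1P k).
Qed.

Lemma initial_uniq (A B : moperad gT) (k k' : mophom A B) :
  is_initial A -> forall n (a : A n), k n a = k' n a.
Proof. by move=> /(_ B)[k1 k1P] n a; rewrite (k1P k) (k1P k'). Qed.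

Lemma gsactM (S : symseq gT) n a b (x : S n) :
  gsact (a * b) x = gsact a (gsact b x).
Proof. by rewrite /gsact invMg /= sactM gactM gsactC. Qed.

Lemma symhom_gsact (S T : symseq gT) (h : symhom S T) n a (x : S n) :
  h n (gsact a x) = gsact a (h n x).
Proof. by rewrite /gsact symhom_gact symhom_sact. Qed.

Lemma graph_group_set n (Gam : {set gT * Sigma n}) :
  graph_subgroup Gam -> group_set Gam.
Proof.
case=> H [s ->]; apply/group_setP; split.
  by apply/imsetP; exists 1; rewrite ?group1 ?morph1.
move=> _ _ /imsetP[x Hx ->] /imsetP[y Hy ->].
by apply/imsetP; exists (x * y); rewrite ?groupM ?morphM.
Qed.

Section OrbitMap.
Variables (n : nat) (Gam : {set gT * Sigma n}).
Hypothesis GamP : graph_subgroup Gam.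

Lemma base_coset : Gam \in lcosets Gam [set: gT * Sigma n].
Proof. by apply/lcosetsP; exists 1; rewrite ?inE ?lcoset1. Qed.

Definition orbit_base : orbit_seq Gam n := OrbitAt (exist _ Gam base_coset).

Lemma orbit_baseE a : gsact a orbit_base =
  OrbitAt (cosets_act a (exist _ Gam base_coset)).
Proof.
rewrite /gsact /= -cosets_actM; congr (OrbitAt (cosets_act _ _)).
by case: a => g s; congr pair; rewrite ?mulg1 ?mul1g // invgK.
Qed.

Lemma orbit_base_fixed : fixed Gam orbit_base.
Proof.
move=> a Gam_a; rewrite orbit_baseE; congr OrbitAt; apply: val_inj => /=.
exact: (@lcoset_id _ (Group (graph_group_set GamP))).
Qed.

Lemma orbit_seq_ind (P : forall m, orbit_seq Gam m -> Prop) :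
  (forall a, P n (gsact a orbit_base)) -> forall m x, P m x.
Proof.
move=> HP m [[C CP]]; have /lcosetsP[a _ CE] := CP.
have -> : OrbitAt (exist _ C CP) = gsact a orbit_base :> orbit_seq Gam n.
  by rewrite orbit_baseE; congr OrbitAt; apply: val_inj.
exact: HP.
Qed.

Lemma orbit_map (S : symseq gT) (x : S n) : fixed Gam x ->
  exists h : symhom (orbit_seq Gam) S, h n orbit_base = x.
Proof.
move=> x_fix.
pose F m (y : orbit_at Gam m) : S m :=
  let: OrbitAt C in orbit_at _ m := y return S m in gsact (repr (val C)) x.
have FE a : F n (gsact a orbit_base) = gsact a x.
  rewrite orbit_baseE /=.
  have /lcosetP[b Gb ->] : repr (a *: Gam) \in a *: Gam.
    apply: (mem_repr a); rewrite mem_lcoset mulVg.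
    exact: (group1 (Group (graph_group_set GamP))).
  by rewrite gsactM x_fix.
have Fg m g (y : orbit_seq Gam m) : F m (gact g y) = gact g (F m y).
  move: m y; apply: orbit_seq_ind => a.
  have E (T : symseq gT) (z : T n) : gact g (gsact a z) = gsact ((g, 1) * a) z.
    by rewrite gsactM [RHS]/gsact /= invg1 sact1.
  by rewrite E !FE E.
have Fs m (y : orbit_seq Gam m) s : F m (sact y s) = sact (F m y) s.
  move: m y s; apply: orbit_seq_ind => a s.
  have E (T : symseq gT) (z : T n) : sact (gsact a z) s = gsact ((1, s^-1) * a) z.
    by rewrite gsactM [RHS]/gsact /= invgK gact1.
  by rewrite E !FE E.
exists (@SymHom gT (orbit_seq Gam) S F Fg Fs).
have gsact_1 (T : symseq gT) (z : T n) : gsact 1 z = z.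
  by rewrite /gsact /= invg1 sact1 gact1.
by have := FE 1; rewrite !gsact_1.
Qed.
End OrbitMap.

Lemma acyc_fibration_fixed (X Y : moperad gT) (p : mophom X Y) n
    (Gam : {set gT * Sigma n}) (y : Y n) :
  acyc_fibration p -> graph_subgroup Gam -> fixed Gam y ->
  exists x : X n, fixed Gam x /\ p n x = y.
Proof.
move=> p_acyc GamP y_fix.
have [A [etaA A_free]] := free_exists (empty_seq gT).
have [B [etaB B_free]] := free_exists (orbit_seq Gam).
have [phi _] := A_free B (from_empty B).
have [a _] := A_free X (from_empty X).
have [h hE] := orbit_map GamP y_fix.
have [b [bE _]] := B_free Y h.
have phi_gen : gen_cof phi.
  by exists n, Gam; split=> //; exists etaA, etaB; split=> // m [].
have sq m (z : A m) : p m (a m z) = b m (phi m z).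
  by apply: (free_uniq A_free (k := comp_mophom p a) (k' := comp_mophom b phi)) => ? [].
have [l [_ lE]] := p_acyc _ _ _ phi_gen a b sq.
exists (l n (etaB n (orbit_base Gam))); split; last by rewrite lE bE.
by move=> c Gc; rewrite -!symhom_gsact orbit_base_fixed.
Qed.

Definition coprod_fam_seq (I : Type) (S : I -> symseq gT) : symseq gT.
Proof.
apply: (@SymSeq gT (fun n => {i : I & S i n})
  (fun n g x => existT (fun i => S i n) _ (gact g (projT2 x)))
  (fun n x s => existT (fun i => S i n) _ (sact (projT2 x) s))).
- by move=> n [i x] /=; rewrite gact1.
- by move=> n g h [i x] /=; rewrite gactM.
- by move=> n [i x] /=; rewrite sact1.
- by move=> n [i x] s t /=; rewrite sactM.
- by move=> n g [i x] s /=; rewrite gsactC.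
Defined.

Definition coprod_in (I : Type) (S : I -> symseq gT) (i : I) :
  symhom (S i) (coprod_fam_seq S).
Proof.
exact: (@SymHom gT (S i) (coprod_fam_seq S)
  (fun n x => existT (fun i => S i n) i x)).
Defined.

Definition coprod_case (I : Type) (S : I -> symseq gT) (T : symseq gT)
  (h : forall i, symhom (S i) T) : symhom (coprod_fam_seq S) T.
Proof.
apply: (@SymHom gT (coprod_fam_seq S) T (fun n x => h (projT1 x) n (projT2 x))).
- by move=> n g [i x] /=; rewrite symhom_gact.
- by move=> n [i x] s /=; rewrite symhom_sact.
Defined.

Theorem cofibrant_replacement_exists (O : moperad gT) :
  exists (Q : moperad gT) (q : mophom Q O), cofibrant_replacement q.
Proof.
pose I := {n : nat & {Gam : {set gT * Sigma n} &
  {x : O n | graph_subgroup Gam /\ fixed Gam x}}}.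
pose Gm (i : I) := projT1 (projT2 i).
pose S (i : I) := orbit_seq (Gm i).
have gG (i : I) : graph_subgroup (Gm i).
  by case: i => n [Gam [x []]].
have [A [eta A_free]] := free_exists (coprod_fam_seq S).
pose base (i : I) := coprod_in S i _ (orbit_base (Gm i)).
have base_fixed i : fixed (Gm i) (base i).
  by move=> a Ga; rewrite -symhom_gsact orbit_base_fixed.
have base_uniq (T : symseq gT) (h h' : symhom (coprod_fam_seq S) T) :
    (forall i, h _ (base i) = h' _ (base i)) -> forall n x, h n x = h' n x.
  move=> E n [i x].
  change (h n (coprod_in S i n x) = h' n (coprod_in S i n x)).
  move: n x; apply: orbit_seq_ind => a.
  by rewrite !symhom_gsact E.
have [q _] : exists q : mophom A O, True.
  have hx (i : I) : {h : symhom (S i) O | True}.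
    apply: cid; case: i => n [Gam [x [Gg xf]]].
    by have [h _] := orbit_map Gg xf; exists h.
  have [k _] := A_free O (coprod_case (fun i => sval (hx i))).
  by exists k.
exists A, q; split; last first.
  move=> n Gam Gg [x xf].
  pose i : I := existT _ n (existT _ Gam (exist _ x (conj Gg xf))).
  exists (eta n (base i)) => a Ga.
  rewrite -(symhom_gsact eta); congr (eta n _); exact: (base_fixed i a Ga).
have [Z Z_init] := initial_exists gT.
have [zeta _] := Z_init A.
exists Z, zeta; split=> // X Y p p_acyc a b sq.
have hx (i : I) : {h : symhom (S i) X |
    p _ (h _ (orbit_base (Gm i))) = b _ (eta _ (base i))}.
  apply: cid.
  have bf : fixed (Gm i) (b _ (eta _ (base i))).
    by move=> c Gc; rewrite -(symhom_gsact b) -(symhom_gsact eta) base_fixed.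
  have [x [xf xE]] := acyc_fibration_fixed p_acyc (gG i) bf.
  by have [h hE] := orbit_map (gG i) xf; exists h; rewrite hE.
have [l [lE _]] := A_free X (coprod_case (fun i => sval (hx i))).
exists l; split=> n x.
  exact: (initial_uniq (comp_mophom l zeta) a Z_init).
apply: (free_uniq A_free (k := comp_mophom p l) (k' := b)) => {n x}.
apply: (base_uniq _ (comp_symhom (comp_mophom p l) eta) (comp_symhom b eta)) => i /=.
by rewrite lE /= (svalP (hx i)).
Qed.
End CofibrantReplacementExists.

Section FibrantReplacementExists.
Variable gT : finGroupType.

Definition terminal_seq : symseq gT.
Proof.
by apply: (@SymSeq gT (fun=> unit) (fun _ _ x => x) (fun _ x _ => x)).
Defined.

Lemma terminal_tag m n (x : terminal_seq m) (y : terminal_seq n) :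
  m = n -> tagop terminal_seq x = tagop terminal_seq y.
Proof. by case: x y => [] [] ->. Qed.

Definition terminal_op : operad gT.
Proof.
apply: (@Operad gT terminal_seq tt (fun _ _ _ _ => tt)).
- by move=> n d; apply: terminal_tag; rewrite big_ord1.
- by move=> k c; apply: terminal_tag; rewrite sum1_card card_ord.
- by move=> k j c d r e; apply: terminal_tag; apply: sum_blocks.
- by move=> k j c d s; apply: terminal_tag; rewrite -sum_perm.
- by [].
- by [].
- by [].
Defined.

Definition terminal : moperad gT.
Proof. by apply: (@MOperad gT terminal_op tt tt). Defined.

Lemma terminal_is_terminal : is_terminal terminal.
Proof.
move=> B.
unshelve eexists.
  by unshelve refine (@MOpHom gT B terminal
    (@SymHom gT B terminal (fun _ _ => tt) _ _) _ _ _ _).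
by move=> k n x; case: (k n x).
Qed.

Theorem all_fibrant (O : moperad gT) : fibrant O.
Proof.
have [p _] := terminal_is_terminal O.
exists terminal, p; split; first exact: terminal_is_terminal.
move=> A B i [n [Gam [GamP [etaA [etaB [A_free B_free iE]]]]]] a b sq.
pose h0 : symhom (orbit_seq Gam) O := comp_symhom a etaA.
have [h hE] : exists h : symhom (coprod_seq (orbit_seq Gam) (orbit_seq Gam)) O,
    forall m x, h m (inl x) = h0 m x.
  unshelve eexists.
    unshelve refine (@SymHom gT (coprod_seq (orbit_seq Gam) (orbit_seq Gam)) O
      (fun m x => match x with inl y => h0 m y | inr y => h0 m y end) _ _).
    - by move=> m g [] x; apply: (@symhom_gact _ _ _ h0).
    - by move=> m [] x s; apply: (@symhom_sact _ _ _ h0).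
  by [].
have [l [lE _]] := B_free O h.
exists l; split=> m x; last by case: (p m (l m x)) (b m x) => [] [].
apply: (free_uniq A_free (k := comp_mophom l i) (k' := a)) => {}m {}x /=.
by rewrite iE lE; apply: hE.
Qed.

Theorem fibrant_replacement_exists (O : moperad gT) :
  exists (R : moperad gT) (r : mophom O R), fibrant_replacement r.
Proof.
have idP : mophom O O.
  by unshelve refine (@MOpHom gT O O
    (@SymHom gT O O (fun _ x => x) _ _) _ _ _ _).
exists O, idP; split; first exact: all_fibrant.
by [].
Qed.
End FibrantReplacementExists.

Section DerivedFunctorsExist.
Variables (gT gT' : finGroupType) (f : {morphism [set: gT] >-> gT'}).

Theorem Lres_exists (O : moperad gT') : exists P, is_Lres f O P.
Proof.
have [Q [q qP]] := cofibrant_replacement_exists O.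
by exists (res f Q), Q, q.
Qed.

Theorem Lind_exists (O : moperad gT) : exists P, is_Lind f O P.
Proof.
have [Q [q qP]] := cofibrant_replacement_exists O.
have [P [eta etaP]] := ind_exists f Q.
by exists P, Q, q, eta.
Qed.

Theorem Rcoind_exists (O : moperad gT) : exists P, is_Rcoind f O P.
Proof.
have [R [r rP]] := fibrant_replacement_exists O.
have [P [eps epsP]] := coind_exists f R.
by exists P, R, r, eps.
Qed.
End DerivedFunctorsExist.

(* Main.v *)
(* For a marked operad O, an H-set T carries an H-fixed operation of O exactly
   when Stab(t) ->_O H for every t in T: the marked nullary operation discards
   inputs, the marked binary one sums trivial H-sets, and composition assembles
   an H-set from its image under an equivariant map and the fibres.  It follows
   that ->_O is a transfer system, and that a cofibrant Q maps to any M with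
   ->_Q contained in ->_M, since then Q x M -> Q is an acyclic fibration.

   Conversely every transfer system is ->_N for an operad N of trees.  So the
   minimality of ->_(res Q) and ->_(ind Q) is obtained by mapping Q to coind N
   and to res N and passing to adjoints.  The relation of coind O is computed
   on double cosets of f(G) and H: it contains (K, H) as soon as f^-1(aKa^-1)
   ->_O f^-1(aHa^-1) for all a. *)
Require Import Defs.
From mathcomp Require Import all_boot all_order all_fingroup.
From mathcomp Require Import boolp.
Import Defs.

Set Implicit Arguments.
Unset Strict Implicit.
Unset Printing Implicit Defensive.

Local Open Scope group_scope.

(** * Operations up to relabelling of the inputs *)

Lemma sigma_ext n (s t : Sigma n) : s =1 t -> s = t.
Proof. by move=> E; apply/permP => i; apply: E. Qed.

(* Without the cast, a product or an inverse in Sigma n would be applied through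
   the coercion of permutations instead of sigma_app. *)
Lemma sigma_app1 n i : sigma_app (1 : Sigma n) i = i.
Proof. exact: perm1. Qed.

Lemma sigma_appM n (s t : Sigma n) i : sigma_app (s * t) i = s (t i).
Proof. exact: sigmaM. Qed.

Lemma sigmaK n (s : Sigma n) : cancel s (sigma_app s^-1).
Proof. by move=> i; rewrite -sigma_appM mulVg sigma_app1. Qed.

Lemma sigmaKV n (s : Sigma n) : cancel (sigma_app s^-1) s.
Proof. by move=> i; rewrite -sigma_appM mulgV sigma_app1. Qed.

Section Relabelling.
Variable gT : finGroupType.

(** Equality up to a permutation of the inputs, with underlying function [phi]. The arities may be
    equal only propositionally; comparing indices as natural numbers avoids casts in composites. *)
Definition relab (S : symseq gT) m n (x : S m) (y : S n) (phi : 'I_m -> 'I_n) :=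
  exists s : Sigma n, tagop S x = tagop S (sact y s) /\
    forall (i : 'I_m) (j : 'I_n), i = j :> nat -> phi i = s j.

Lemma relab_sact (S : symseq gT) n (y : S n) (s : Sigma n) : relab (sact y s) y s.
Proof. by exists s; split=> // i j /val_inj ->. Qed.

Lemma relab_arity (S : symseq gT) m n (x : S m) (y : S n) phi :
  relab x y phi -> m = n.
Proof. by case=> s [/(congr1 (@projT1 _ _))]. Qed.

Lemma relabP (S : symseq gT) n (x y : S n) phi :
  relab x y phi <-> exists2 s : Sigma n, x = sact y s & phi =1 s.
Proof.
split=> [[s [/tagop_inj -> E]]|[s -> E]].
  by exists s => // i; apply: E.
by exists s; split=> // i j /val_inj ->.
Qed.

Lemma relab_trans (S : symseq gT) m n p (x : S m) (y : S n) (z : S p) phi psi chi :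
  relab x y phi -> relab y z psi -> chi =1 psi \o phi -> relab x z chi.
Proof.
move=> xy yz; have e := relab_arity xy; have e' := relab_arity yz; subst.
move: xy yz => /relabP[s -> E] /relabP[t -> E'] E2.
by apply/relabP; exists (t * s) => [|i]; rewrite ?sactM // E2 /= E E' sigma_appM.
Qed.

Lemma relab_sym (S : symseq gT) m n (x : S m) (y : S n) phi psi :
  relab x y phi -> cancel psi phi -> relab y x psi.
Proof.
move=> xy K; have e := relab_arity xy; subst.
move: xy => /relabP[s -> E]; apply/relabP.
exists s^-1 => [|i]; first by rewrite -sactM mulgV sact1.
by rewrite -{2}[i]K E sigmaK.
Qed.

Lemma relab_gact (S : symseq gT) m n (x : S m) (y : S n) phi g :
  relab x y phi -> relab (gact g x) (gact g y) phi.
Proof.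
move=> xy; have e := relab_arity xy; subst.
move: xy => /relabP[s -> E]; apply/relabP.
by exists s => //; rewrite gsactC.
Qed.

(** Both equivariance axioms at once: [opcomp_sum] extracts the relabellings [psi i] as a block sum,
    then [opcomp_perm] extracts [phi] as a block permutation. *)
Lemma relab_opcomp (O : operad gT) k k' (j : 'I_k -> nat) (j' : 'I_k' -> nat)
    (c : O k) (c' : O k') (d : forall i, O (j i)) (d' : forall i, O (j' i))
    (phi : 'I_k -> 'I_k') (psi : forall i, 'I_(j i) -> 'I_(j' (phi i)))
    (chi : 'I_(\sum_i j i) -> 'I_(\sum_i j' i)) :
  relab c c' phi -> (forall i, relab (d i) (d' (phi i)) (@psi i)) ->
  (forall i l, chi (tagnat.Rank i l) = tagnat.Rank (phi i) (psi i l)) ->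
  relab (opcomp c d) (opcomp c' d') chi.
Proof.
move=> cc' dd' chiE; have e := relab_arity cc'; subst k'.
move: cc' => /relabP[s cE /funext phiE]; subst c phi.
have e : j = fun i => j' (s i) by apply/funext => i; apply: relab_arity (dd' i).
subst j.
have dP i : {t | d i = sact (d' (s i)) t /\ @psi i =1 t}.
  by apply: cid; have /relabP[t] := dd' i; exists t.
have [t dE] : {t : forall i, Sigma (j' (s i)) |
    forall i, d i = sact (d' (s i)) (t i) /\ @psi i =1 t i}.
  by exists (fun i => sval (dP i)) => i; exact: (svalP (dP i)).
clear dP dd'.
have {dE} [dE psiE] : d = (fun i => sact (d' (s i)) (t i)) /\
    forall i, @psi i =1 t i.
  by split=> [|i]; [apply/functional_extensionality_dep => i|]; case: (dE i).
subst d; rewrite opcomp_sum.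
have bs := relab_sact (opcomp (sact c' s) (fun i => d' (s i))) (block_sum t).
have cE := esym (sum_perm s j').
(* The two arities are identified only by [sum_perm], hence the cast. *)
pose bp x := block_perm s j' (cast_ord cE x).
have bpE : relab (opcomp (sact c' s) (fun i => d' (s i))) (opcomp c' d') bp.
  exists (block_perm s j'); split=> [|x y xy]; first exact: opcomp_perm.
  by congr (block_perm _ _ _); apply: val_inj.
apply: (relab_trans bs bpE) => x /=.
rewrite -(tagnat.sigK x) tagnat.rankE; set i := tag _; set l := tagged _.
rewrite chiE /bp /block_perm /block_sum !sigma_permE psiE.
rewrite /block_perm_fun /block_sum_fun.
rewrite (_ : cast_ord _ _ = tagnat.Rank i (t i l)).
  by rewrite /tagnat.Rank !tagnat.rankK.
apply: val_inj => /=.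
by rewrite /tagnat.sig1 /tagnat.sig2 /tagnat.Rank !tagnat.rankK.
Qed.
End Relabelling.

(** * Admissible H-sets *)

Section Admissible.
Variable gT : finGroupType.
Implicit Types (H K L : {group gT}).

(* (n, e, x) is an operation x of arity n whose inputs are labelled through e
   by the elements of the H-set D, and which is H-fixed up to the action on the
   labels. *)
Definition labelled_op (S : symseq gT) (T : Type) : Type :=
  {n : nat & (('I_n -> T) * S n)%type}.

Definition labelled (S : symseq gT) (T : Type) n (e : 'I_n -> T) (x : S n) :
  labelled_op S T := existT _ n (e, x).

(** Testing every [phi] that lifts the action through the labels avoids choosing a homomorphism from
    [H] to [Sigma n]. *)
Definition is_admissible (S : symseq gT) (H : {set gT}) (T : finType)
    (act : gT -> T -> T) (D : {set T}) (w : labelled_op S T) : Prop :=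
  let: existT n (e, x) := w in
  [/\ injective e, e @: [set: 'I_n] = D &
      forall h (phi : 'I_n -> 'I_n), h \in H ->
        (forall i, e (phi i) = act h (e i)) -> relab (gact h x) x phi].

Definition admissible (S : symseq gT) (H : {set gT}) (T : finType)
    (act : gT -> T -> T) (D : {set T}) : Prop :=
  exists w, @is_admissible S H T act D w.

(** The action law holds on all of [T] and [D] is only a stable subset, so that orbits and fibres
    share one [act]. *)
Definition gset (H : {set gT}) (T : finType) (act : gT -> T -> T) (D : {set T}) :=
  [/\ forall t, act 1 t = t,
      {in H &, forall g h t, act (g * h) t = act g (act h t)} &
      forall h t, h \in H -> t \in D -> act h t \in D].

Definition stab (H : {set gT}) (T : finType) (act : gT -> T -> T) (t : T) :=
  [set h in H | act h t == t].

Lemma imset_labelP (T : finType) (D : {set T}) n (e : 'I_n -> T) t :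
  e @: [set: 'I_n] = D -> t \in D -> {i | e i = t}.
Proof. by move=> <- tD; apply: cid; case/imsetP: tD => i _ ->; exists i. Qed.

Lemma imset_label (T : finType) (D : {set T}) n (e : 'I_n -> T) i :
  e @: [set: 'I_n] = D -> e i \in D.
Proof. by move=> <-; apply: imset_f; rewrite inE. Qed.

Lemma gset_inj H (T : finType) act (D : {set T}) h :
  gset H act D -> h \in H -> injective (act h).
Proof.
case=> a1 aM _ Hh t t' E; rewrite -(a1 t) -(a1 t') -(mulVg h).
by rewrite !aM ?groupV // E.
Qed.

Lemma gsetK H (T : finType) act (D : {set T}) h t :
  gset H act D -> h \in H -> act h^-1 (act h t) = t.
Proof. by case=> a1 aM _ Hh; rewrite -aM ?groupV // mulVg. Qed.

Lemma gsetKV H (T : finType) act (D : {set T}) h t :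
  gset H act D -> h \in H -> act h (act h^-1 t) = t.
Proof. by case=> a1 aM _ Hh; rewrite -aM ?groupV // mulgV. Qed.

Lemma gsetS H K (T : finType) act (D : {set T}) :
  K \subset H -> gset H act D -> gset K act D.
Proof.
move=> /subsetP sKH [a1 aM aD]; split=> // [g h Kg Kh t|h t Kh].
  by apply: aM; apply: sKH.
by apply: aD; apply: sKH.
Qed.

Lemma stab_group_set H (T : finType) act (D : {set T}) t :
  gset H act D -> group_set (stab H act t).
Proof.
case=> a1 aM _; apply/group_setP; split; first by rewrite inE group1 a1 /=.
move=> g h; rewrite !inE => /andP[Hg /eqP gt] /andP[Hh /eqP ht].
by rewrite groupM //= aM // ht gt.
Qed.

Lemma admissibleS (S : symseq gT) (H K : {set gT}) (T : finType) act (D : {set T}) :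
  K \subset H -> admissible S H act D -> admissible S K act D.
Proof.
move=> /subsetP sKH [[n [e x]] [e_inj eD xP]]; exists (labelled e x).
by split=> // h phi /sKH; apply: xP.
Qed.

Lemma admissible_iso (S : symseq gT) (H : {set gT}) (T T' : finType)
    act act' (D : {set T}) (D' : {set T'}) (f : T -> T') :
  (forall h t, h \in H -> t \in D -> act h t \in D) ->
  {in D &, injective f} -> f @: D = D' ->
  {in H & D, forall h t, f (act h t) = act' h (f t)} ->
  admissible S H act D <-> admissible S H act' D'.
Proof.
move=> aD f_inj fD fE; split=> [[[n [e x]] [e_inj eD xP]]|].
  exists (labelled (f \o e) x); split=> /=.
  - move=> i i' /f_inj E; apply/e_inj/E; exact: imset_label eD.
  - by rewrite imset_comp eD.
  - move=> h phi Hh E; apply: xP => // i; have eiD := imset_label i eD.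
    by apply: f_inj; rewrite ?aD ?(imset_label _ eD) // E fE.
case=> [[n [e x]] [e_inj eD xP]].
have pre i : {t | t \in D & f t = e i}.
  apply: cid2; have := imset_label i eD; rewrite -fD.
  by case/imsetP=> t tD ->; exists t.
pose e0 i := s2val (pre i).
have e0D i : e0 i \in D := s2valP (pre i).
have e0E i : f (e0 i) = e i := s2valP' (pre i).
exists (labelled e0 x); split.
- by move=> i i' /(congr1 f); rewrite !e0E => /e_inj.
- apply/setP => t; apply/imsetP/idP => [[i _ ->] //|tD].
  have ftD : f t \in D' by rewrite -fD imset_f.
  have [i ei] := imset_labelP eD ftD.
  by exists i; rewrite // (f_inj _ _ _ _ (etrans (e0E i) ei)).
- by move=> h phi Hh E; apply: xP => // i; rewrite -!e0E E fE.
Qed.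

(** Two labellings of [D] differ by a permutation, which [sact] absorbs into the operation. *)
Lemma admissible_label (S : symseq gT) (H : {set gT}) (T : finType) act
    (D : {set T}) n (e : 'I_n -> T) :
  injective e -> e @: [set: 'I_n] = D -> admissible S H act D ->
  exists x, is_admissible H act D (labelled e (x : S n)).
Proof.
move=> e_inj eD [[m [e' x]] [e'_inj e'D xP]].
have mn : m = n.
  rewrite -[m]card_ord -[n]card_ord -!cardsT.
  by rewrite -(card_imset _ e_inj) -(card_imset _ e'_inj) eD e'D.
subst m.
have aP i := imset_labelP e'D (imset_label i eD).
pose a i := sval (aP i); have aE i : e' (a i) = e i := svalP (aP i).
have a_inj : injective a.
  by move=> i i' /(congr1 e'); rewrite !aE => /e_inj.
pose s : Sigma n := sigma_perm a_inj.
have sE i : e' (s i) = e i by rewrite sigma_permE aE.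
exists (sact x s); split=> // h phi Hh E.
have E' i : e' (s (phi (sigma_app s^-1 i))) = act h (e' i).
  by rewrite sE E -sE sigmaKV.
have xs := relab_sact x s.
have sx := relab_sym xs (sigmaKV s).
apply: (relab_trans (relab_gact h xs)
  (relab_trans (xP h _ Hh E') sx (frefl _))) => i /=.
by rewrite sigmaK sigmaK.
Qed.

(** Compose an operation labelled by the base [B] with operations labelled by the fibres of [p]. One
    admissible fibre per orbit of [B] suffices, the others being its translates. *)
Lemma admissible_total (O : moperad gT) H (S T : finType) aS aT
    (B : {set S}) (D : {set T}) (p : T -> S) :
  gset H aS B -> gset H aT D ->
  {in D, forall t, p t \in B} ->
  {in H & D, forall h t, p (aT h t) = aS h (p t)} ->
  admissible O H aS B ->
  (forall s, s \in B -> exists2 h, h \in H &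
     admissible O (stab H aS (aS h s)) aT [set t in D | p t == aS h s]) ->
  admissible O H aT D.
Proof.
move=> gB gD pB pE [[k [ec c]] [ec_inj ecB cP]] fibP.
have [a1S aMS aSB] := gB; have [a1T aMT aTD] := gD.
(* The fibre over s is transported along g s from that over the representative
   rep s of the orbit of s. *)
pose fib s := [set t in D | p t == s].
pose good s := `[< admissible O (stab H aS s) aT (fib s) >].
pose orb s := [set aS h s | h in H].
have orbE h s : h \in H -> orb (aS h s) = orb s.
  move=> Hh; apply/setP => r; apply/imsetP/imsetP => [[g Hg ->]|[g Hg ->]].
    by exists (g * h); rewrite ?groupM // aMS.
  by exists (g * h^-1); rewrite ?groupM ?groupV // aMS ?groupV // (gsetK _ gB).
(* The choice depends only on the set [orb s], so [rep] is constant on orbits in [B]; there [fibP]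
   excludes the default [s]. *)
pose rep s := odflt s [pick r in orb s | good r].
have repP s : s \in B -> exists2 g, g \in H & aS g (rep s) = s /\ good (rep s).
  move=> sB; rewrite /rep; case: pickP => [r /andP[/imsetP[g Hg ->] gr]|no].
    by exists g^-1; rewrite ?groupV // (gsetK _ gB).
  have [h Hh /asboolP hs] := fibP s sB.
  by have := no (aS h s); rewrite imset_f //= => /negP[].
have repE h s : s \in B -> h \in H -> rep (aS h s) = rep s.
  move=> sB Hh; have [h' Hh' /asboolP hs] := fibP s sB.
  rewrite /rep orbE //; case: pickP => // /(_ (aS h' s)).
  by rewrite imset_f //= => /negP[].
have [g gP] : exists g : S -> gT, forall s, s \in B ->
    [/\ g s \in H, aS (g s) (rep s) = s & good (rep s)].
  suff /choice[g gP] : forall s, exists g, s \in B ->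
    [/\ g \in H, aS g (rep s) = s & good (rep s)] by exists g.
  move=> s; case: (boolP (s \in B)) => [/repP[g Hg []]|_]; last by exists 1.
  by exists g.
have [w wP] : exists w : S -> labelled_op O T, forall s, good s ->
    is_admissible (stab H aS s) aT (fib s) (w s).
  suff /choice[w wP] : forall s, exists w : labelled_op O T, good s ->
    is_admissible (stab H aS s) aT (fib s) w by exists w.
  move=> s; case: (boolP (good s)) => [/asboolP[w]|_]; first by exists w.
  (* Default value off the good points: the nullary mark needs no element of [T]. *)
  by exists (labelled (fun i : 'I_0 => False_rect T (notF (ltn_ord i))) (mark0 O)).
pose n s := projT1 (w s).
pose E s : 'I_(n s) -> T := (projT2 (w s)).1.
pose d s : O (n s) := (projT2 (w s)).2.
have wP0 s : good s -> [/\ injective (@E s), @E s @: [set: 'I_(n s)] = fib s &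
    forall h (phi : 'I_(n s) -> 'I_(n s)), h \in stab H aS s ->
      (forall i, E s (phi i) = aT h (E s i)) -> relab (gact h (d s)) (d s) phi].
  by move=> /wP; rewrite /E /d /n; case: (w s) => m [? ?].
have ecBi i := imset_label i ecB.
pose j i := n (rep (ec i)).
pose ed i (l : 'I_(j i)) : T := aT (g (ec i)) (E (rep (ec i)) l).
have edP i l : ed i l \in fib (ec i).
  have [Hg gE /wP0[_ Eim _]] := gP _ (ecBi i).
  have := imset_label l Eim; rewrite !inE => /andP[tD /eqP pt].
  by rewrite aTD //= pE // pt gE.
have edS i t : t \in fib (ec i) -> exists l, ed i l = t.
  rewrite inE => /andP[tD /eqP pt].
  have [Hg gE /wP0[_ Eim _]] := gP _ (ecBi i).
  have t'fib : aT (g (ec i))^-1 t \in fib (rep (ec i)).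
    rewrite inE aTD ?groupV //= pE ?groupV // pt; apply/eqP.
    by apply: (gset_inj gB Hg); rewrite (gsetKV _ gB) // gE.
  have [l lE] := imset_labelP Eim t'fib.
  by exists l; rewrite /ed lE (gsetKV _ gD).
pose e (x : 'I_(\sum_i j i)) := ed (tag (tagnat.sig x)) (tagged (tagnat.sig x)).
have eE i l : e (tagnat.Rank i l) = ed i l by rewrite /e /tagnat.Rank tagnat.rankK.
have e_inj : injective e.
  move=> x y; rewrite /e => xy; apply: tagnat.sig_inj; move: xy.
  case: (tagnat.sig x) (tagnat.sig y) => i l [i' l'] /= xy.
  have ii' : i = i'.
    have := edP i l; rewrite xy inE => /andP[_ /eqP E1].
    have := edP i' l'; rewrite inE => /andP[_ /eqP]; rewrite E1; exact: ec_inj.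
  subst i'; congr existT.
  have [Hg _ /wP0[E_inj _ _]] := gP _ (ecBi i).
  exact/E_inj/(gset_inj gD Hg).
(* Equivariance of the translated family: [(g s')^-1 * h * g s] stabilizes the common
   representative, so it fixes the operation chosen there up to relabelling. *)
have key s s' h : s \in B -> h \in H -> s' = aS h s ->
    forall psi : 'I_(n (rep s)) -> 'I_(n (rep s')),
    (forall l, aT (g s') (E (rep s') (psi l)) = aT h (aT (g s) (E (rep s) l))) ->
    relab (gact h (gact (g s) (d (rep s)))) (gact (g s') (d (rep s'))) psi.
  move=> sB Hh s'E.
  have s'B : s' \in B by rewrite s'E aSB.
  have [Hg gE gr] := gP _ sB; have [Hg' gE' _] := gP _ s'B.
  have repE' : rep s' = rep s by rewrite s'E repE.
  move: (rep s') repE' gE' => r ->{r} gE' psi psiE.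
  rewrite -gactM -[h * _](mulKVg (g s')) [gact (_ * _) _]gactM; apply: relab_gact.
  have [_ _ relP] := wP0 _ gr; apply: relP => [|l].
    rewrite inE !groupM ?groupV //= !aMS ?groupM ?groupV // gE -s'E -{2}gE'.
    by rewrite (gsetK _ gB).
  apply: (gset_inj gD Hg'); rewrite psiE !aMT ?groupM ?groupV //.
  by rewrite (gsetKV _ gD).
exists (labelled e (opcomp c (fun i => gact (g (ec i)) (d (rep (ec i)))))).
split=> //.
  apply/setP => t; apply/imsetP/idP => [[x _ ->]|tD].
    by have := edP (tag (tagnat.sig x)) (tagged (tagnat.sig x)); rewrite inE => /andP[].
  have [i iE] := imset_labelP ecB (pB t tD).
  have /edS[l lE] : t \in fib (ec i) by rewrite inE tD iE /=.
  by exists (tagnat.Rank i l); rewrite ?eE.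
move=> h phi Hh phiE.
have fP i := imset_labelP ecB (aSB h _ Hh (ecBi i)).
pose f i := sval (fP i); have fE i : ec (f i) = aS h (ec i) := svalP (fP i).
have psiP i l : {l' | ed (f i) l' = aT h (ed i l)}.
  apply/cid/edS; have := edP i l; rewrite !inE => /andP[tD /eqP pt].
  by rewrite aTD //= pE // pt fE.
pose psi i l := sval (psiP i l).
have psiE i l : ed (f i) (psi i l) = aT h (ed i l) := svalP (psiP i l).
rewrite gact_opcomp; apply: (relab_opcomp (psi := psi) (cP h f Hh fE)); last first.
  by move=> i l; apply: e_inj; rewrite phiE !eE psiE.
by move=> i; apply: (key _ _ _ (ecBi i) Hh (fE i)) (psiE i).
Qed.
End Admissible.

(** * The transfer system of a marked operad *)

(** Starting from the nullary mark, composing the binary mark with [x] and the identity raises the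
    arity by one and preserves invariance. *)
Lemma fixed_op gT (O : moperad gT) n : exists x : O n, forall g, gact g x = x.
Proof.
elim: n => [|n [x xP]]; first by exists (mark0 O) => g; apply: gact_mark0.
pose j (i : 'I_2) := if i == ord0 then n else 1%N.
pose d (i : 'I_2) : O (j i) :=
  if i == ord0 as b return O (if b then n else 1%N) then x else opid O.
have <- : (\sum_i j i = n.+1)%N by rewrite big_ord_recl big_ord1 /j /= addn1.
exists (opcomp (mark2 O) d) => g; rewrite gact_opcomp gact_mark2.
apply: opcomp_ext => i; rewrite /d /j; case: (i == ord0) => //.
exact: gact_opid.
Qed.

Section TransferSystem.
Variable gT : finGroupType.
Implicit Types (H K L : {group gT}).

Definition coset_act (h : gT) (C : {set gT}) : {set gT} := h *: C.

Definition orb (H : {set gT}) (T : finType) (act : gT -> T -> T) (t : T) :=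
  [set act h t | h in H].

Lemma fixed_graphP (S : symseq gT) H n (s : gT -> Sigma n) (x : S n) :
  fixed (graph H s) x <-> forall h, h \in H -> gact h x = sact x (s h).
Proof.
split=> [xP h Hh|xP _ /imsetP[h Hh ->]].
  have := xP (h, s h) (imset_f _ Hh); rewrite /gsact /= => {2}<-.
  by rewrite -gsactC -sactM mulVg sact1.
by rewrite /gsact /= gsactC xP // -sactM mulgV sact1.
Qed.

Lemma lcoset_id_eq h K : (h *: K == K) = (h \in K).
Proof. by apply/eqP/idP => [<-|/lcoset_id //]; apply: lcoset_refl. Qed.

Lemma gset_lcosets H K : gset H coset_act (lcosets K H).
Proof.
split=> [C|g h _ _ C|h _ Hh /lcosetsP[x Hx ->]]; rewrite /coset_act.
- exact: lcoset1.
- exact: lcosetM.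
- by apply/lcosetsP; exists (h * x); rewrite ?groupM ?lcosetM.
Qed.

Lemma nth_coset_inj K H : injective (fun i : 'I_#|H : K| => nth_coset K H i).
Proof.
have szE : size (enum (lcosets K H)) = #|H : K|.
  by rewrite -cardE card_lcosets.
by move=> i i' /eqP; rewrite nth_uniq ?szE ?enum_uniq // => /eqP/val_inj.
Qed.

Lemma nth_coset_im K H :
  (fun i : 'I_#|H : K| => nth_coset K H i) @: [set: 'I_#|H : K|] = lcosets K H.
Proof.
have szE : size (enum (lcosets K H)) = #|H : K|.
  by rewrite -cardE card_lcosets.
apply/setP => C; apply/imsetP/idP => [[i _ ->]|CH].
  by rewrite -mem_enum mem_nth // szE.
have lt_ix : (index C (enum (lcosets K H)) < #|H : K|)%N.
  by rewrite -[ltnRHS]szE index_mem mem_enum.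
by exists (Ordinal lt_ix); rewrite // /nth_coset /= nth_index // mem_enum.
Qed.

(** For the labelling [nth_coset], the permutation by which [h] acts on the labels is
    [coset_perm K H h]. *)
Lemma admissible_cosetP (S : symseq gT) K H :
  admissible S H coset_act (lcosets K H) <-> has_fixed S (coset_graph K H).
Proof.
split=> [/(admissible_label (@nth_coset_inj K H) (nth_coset_im K H))|].
  case=> x [_ _ xP]; exists x; apply/fixed_graphP => h Hh.
  have /relabP[s -> E] := xP h (coset_perm K H h) Hh (coset_permP Hh).
  by congr sact; apply/sigma_ext => i; rewrite -E.
case=> x /fixed_graphP xP; exists (labelled (fun i : 'I_#|H : K| => nth_coset K H i) x).
split; [exact: nth_coset_inj | exact: nth_coset_im | move=> h phi Hh E].
apply/relabP; exists (coset_perm K H h); first exact: xP.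
by move=> i; apply: (@nth_coset_inj K H); rewrite E coset_permP.
Qed.

Lemma has_fixed_graphP (S : symseq gT) H n (s : {morphism H >-> Sigma n}) :
  has_fixed S (graph H s) <->
  admissible S H (fun h => sigma_app (s h)) [set: 'I_n].
Proof.
have im_id : (@id 'I_n) @: [set: 'I_n] = [set: 'I_n] by rewrite imset_id.
split=> [[x /fixed_graphP xP]|/(admissible_label (@inj_id 'I_n) im_id)].
  exists (labelled id x); split=> // h phi Hh E.
  by apply/relabP; exists (s h); rewrite // xP.
case=> x [_ _ xP]; exists x; apply/fixed_graphP => h Hh.
have /relabP[t -> E] := xP h (s h) Hh (fun i => erefl).
by congr sact; apply/sigma_ext => i; rewrite -E.
Qed.

Lemma gset_graph H n (s : {morphism H >-> Sigma n}) :
  gset H (fun h => sigma_app (s h)) [set: 'I_n].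
Proof.
split=> [i|g h Hg Hh i|h i _ _]; last by rewrite inE.
  by rewrite morph1 sigma_app1.
by rewrite morphM // sigma_appM.
Qed.

Lemma gset_orb H (T : finType) act (D : {set T}) t :
  gset H act D -> gset H act (orb H act t).
Proof.
case=> a1 aM aD; split=> // g _ Hg /imsetP[h Hh ->].
by rewrite -aM // imset_f // groupM.
Qed.

(** Orbit-stabilizer: [x *: K] corresponds to [act x t], which does not depend on the element that
    [repr] picks in the coset. *)
Lemma admissible_orb (S : symseq gT) H K (T : finType) act (D : {set T}) t :
  gset H act D -> K = stab H act t :> {set gT} ->
  admissible S H act (orb H act t) <-> has_fixed S (coset_graph K H).
Proof.
move=> gD KE; have [a1 aM aD] := gD; rewrite -admissible_cosetP.
pose f (C : {set gT}) := act (repr C) t.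
have fE x : x \in H -> f (x *: K) = act x t.
  move=> Hx; have /lcosetP[k + E] := mem_repr x (lcoset_refl K x).
  by rewrite /f E KE inE => /andP[Hk /eqP kt]; rewrite aM // kt.
apply: iff_sym; apply: (@admissible_iso _ _ _ _ _ _ _ _ _ f).
- by case: (gset_lcosets H K).
- move=> _ _ /lcosetsP[x Hx ->] /lcosetsP[y Hy ->]; rewrite !fE // => E.
  apply/lcoset_eqP; rewrite mem_lcoset KE inE groupM ?groupV //=.
  by rewrite aM ?groupV // E (gsetK _ gD).
- apply/setP => u; apply/imsetP/imsetP => [[_ /lcosetsP[x Hx ->] ->]|[x Hx ->]].
    by exists x; rewrite ?fE.
  by exists (x *: K); rewrite ?fE //; apply/lcosetsP; exists x.
- move=> h _ Hh /lcosetsP[x Hx ->].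
  by rewrite /coset_act -lcosetM !fE ?groupM // aM.
Qed.

Variable O : moperad gT.

Lemma admissible_triv (H : {set gT}) (T : finType) act (D : {set T}) :
  {in H & D, forall h t, act h t = t} -> admissible O H act D.
Proof.
move=> actE; have [x xP] := fixed_op O #|D|.
have imE : (@enum_val _ (mem D)) @: [set: 'I_#|D|] = D.
  apply/setP => t; apply/imsetP/idP => [[i _ ->]|tD]; first exact: enum_valP.
  by exists (enum_rank_in tD t); rewrite ?inE // enum_rankK_in.
exists (labelled (@enum_val _ (mem D)) x); split=> //; first exact: enum_val_inj.
move=> h phi Hh E; rewrite xP; apply/relabP; exists 1; first by rewrite sact1.
move=> i; rewrite sigma_app1; apply: enum_val_inj; rewrite E actE //.
exact: enum_valP.
Qed.

(** The inclusion of [D1] in [D] has fibres with at most one point, on which stabilizers act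
    trivially; over an empty fibre the input is closed by a nullary operation. *)
Lemma admissible_subset H (T : finType) act (D D1 : {set T}) :
  gset H act D -> gset H act D1 -> D1 \subset D ->
  admissible O H act D -> admissible O H act D1.
Proof.
move=> gD gD1 /subsetP sD aD; have [a1 _ _] := gD.
apply: (admissible_total (p := id) gD gD1 _ _ aD) => // s sD'.
exists 1; rewrite ?group1 // a1; apply: admissible_triv => h t.
by rewrite !inE => /andP[_ /eqP hs] /andP[_ /eqP ->].
Qed.

(** An orbit is a stable subset, which gives one direction. For the other, [D] lies over its set of
    orbits, a trivial [H]-set whose fibres are the orbits themselves. *)
Lemma admissibleP H (T : finType) act (D : {set T}) :
  gset H act D ->
  admissible O H act D <->
  {in D, forall t, forall K, K = stab H act t :> {set gT} -> transfer O K H}.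
Proof.
move=> gD; have [a1 aM aD] := gD; split=> [adm t tD K KE|tr].
  split; first by rewrite KE; apply/subsetP => h; rewrite inE => /andP[].
  apply/(admissible_orb _ gD KE)/(admissible_subset gD (gset_orb t gD)) => //.
  by apply/subsetP => _ /imsetP[h Hh ->]; apply: aD.
have orbE h t : h \in H -> orb H act (act h t) = orb H act t.
  move=> Hh; apply/setP => r; apply/imsetP/imsetP => [[g Hg ->]|[g Hg ->]].
    by exists (g * h); rewrite ?groupM // aM.
  by exists (g * h^-1); rewrite ?groupM ?groupV // aM ?groupV // (gsetK _ gD).
have mem_orb t : t \in orb H act t by apply/imsetP; exists 1; rewrite ?group1.
pose B := [set orb H act t | t in D].
have gB : gset H (fun _ s => s) B by [].
apply: (admissible_total (p := orb H act) gB gD).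
- by move=> t tD; apply: imset_f.
- by move=> h t Hh _; apply: orbE.
- exact: admissible_triv.
- move=> _ /imsetP[t tD ->]; exists 1; first exact: group1.
  have -> : [set t' in D | orb H act t' == orb H act t] = orb H act t.
    apply/setP => t'; rewrite inE; apply/andP/idP => [[_ /eqP <-]//|].
    by case/imsetP=> h Hh ->; rewrite aD // orbE.
  apply: (@admissibleS _ _ H); first by apply/subsetP => h; rewrite inE => /andP[].
  pose K := Group (stab_group_set t gD).
  by apply/(admissible_orb _ gD (erefl : K = _ :> {set gT})); case: (tr t tD K erefl).
Qed.

(** If [x] is labelled by H/K, then [gact g x] is fixed by the conjugate of [H], acting on the same
    labels through [k ^ g]; the coset [K] then has stabilizer [K :^ g^-1]. *)
Lemma transfer_conj g K H :
  transfer O K H -> transfer O (K :^ g^-1)%G (H :^ g^-1)%G.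
Proof.
case=> sKH /admissible_cosetP[[n [e x]] [e_inj eE xP]].
pose act k C := coset_act (k ^ g) C.
have gD : gset (H :^ g^-1)%G act (lcosets K H).
  split=> [C|k k' _ _ C|k C]; rewrite /act /coset_act.
  - by rewrite conj1g lcoset1.
  - by rewrite conjMg lcosetM.
  - by rewrite /= mem_conjgV => Hk CH; case: (gset_lcosets H K) => _ _; apply.
apply: (proj1 (admissibleP gD) _ K).
- exists (labelled e (gact g x)); split=> // k phi; rewrite /= mem_conjgV => Hk E.
  rewrite -gactM (conjgC k g) gactM; apply: relab_gact; exact: xP.
- by apply/lcosetsP; exists 1; rewrite ?group1 ?lcoset1.
- apply/setP => k; rewrite inE /= !mem_conjgV /act /coset_act lcoset_id_eq.
  by rewrite andb_idl // => /(subsetP sKH).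
Qed.

(** Transitivity uses the projection of H/L onto H/K, whose fibre over the coset [K] is K/L.
    Restriction uses H/K as an [L]-set, where the coset [K] has stabilizer [L :&: K]. *)
Theorem transfer_is_transfer_system : transfer_system (transfer O).
Proof.
split.
- move=> K; split=> //; apply/admissible_cosetP/admissible_triv => h C Kh.
  by case/lcosetsP=> x Kx ->; rewrite /coset_act !lcoset_id.
- by move=> K H [sKH _] [sHK _]; apply/group_inj/eqP; rewrite eqEsubset sKH.
- move=> L K H [sLK /admissible_cosetP LK] [sKH /admissible_cosetP KH].
  split; first exact: subset_trans sKH.
  apply/admissible_cosetP.
  apply: (admissible_total (p := fun C => C * K) (gset_lcosets H K)
    (gset_lcosets H L) _ _ KH).
  + move=> _ /lcosetsP[x Hx ->]; apply/lcosetsP; exists x => //.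
    by rewrite -mulgA mulSGid.
  + by move=> h C _ _; rewrite /coset_act mulgA.
  (* Translating by [x^-1] leaves only the fibre over the coset [K] to examine. *)
  + move=> _ /lcosetsP[x Hx ->]; exists x^-1; rewrite ?groupV //.
    rewrite /coset_act lcosetK.
    have -> : stab H coset_act K = K.
      apply/setP => h; rewrite inE /coset_act lcoset_id_eq.
      by rewrite andb_idl // => /(subsetP sKH).
    suff -> : [set C in lcosets L H | C * K == K] = lcosets L K by [].
    have LxK y : y *: L * K = y *: K by rewrite -mulgA mulSGid.
    apply/setP => C; rewrite inE; apply/andP/lcosetsP.
      case=> /lcosetsP[y Hy ->]; rewrite LxK lcoset_id_eq => Ky.
      by exists y.
    case=> y Ky ->; rewrite LxK lcoset_id_eq; split=> //.
    by apply/lcosetsP; exists y; rewrite // (subsetP sKH).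
- by move=> K H [].
- exact: transfer_conj.
- move=> K H L [sKH /admissible_cosetP KH] sLH.
  have gD := gsetS sLH (gset_lcosets H K).
  apply: (proj1 (admissibleP gD) (admissibleS sLH KH) K).
    by apply/lcosetsP; exists 1; rewrite ?group1 ?lcoset1.
  by apply/setP => h; rewrite !inE /coset_act lcoset_id_eq.
Qed.
End TransferSystem.

Arguments coset_act {gT} h C.

(** * Realization of transfer systems *)

Lemma lt_Rank k (j : 'I_k -> nat) i i' (l : 'I_(j i)) (l' : 'I_(j i')) :
  (tagnat.Rank i l < tagnat.Rank i' l')%N =
  (i < i')%N || (i == i') && (l < l')%N.
Proof.
pose p := Tagged (fun i => 'I_(j i)) l; pose q := Tagged (fun i => 'I_(j i)) l'.
have -> : (tagnat.Rank i l < tagnat.Rank i' l')%N =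
    (i <= i')%N && ((i' <= i)%N ==> (l < tagged_as p q)%N).
  exact: (tagnat.lt_rank p q).
case: (eqVneq i i') => [ii'|]; last first.
  by rewrite -val_eqE /=; case: (ltngtP i i').
by case: _ / ii' l' @q => l' q; rewrite tagged_asE leqnn ltnn.
Qed.

(** Both sides count the positions that come before: whole outer blocks, then inner blocks of block
    [i], then [m]. This gives associativity of grafting below. *)
Lemma Rank_Rank k (j : 'I_k -> nat) (r : 'I_(\sum_i j i) -> nat) i l
    (m : 'I_(r (tagnat.Rank i l))) :
  tagnat.Rank (tagnat.Rank i l) m =
  @tagnat.Rank k (fun i => \sum_l r (tagnat.Rank i l))%N i
    (@tagnat.Rank (j i) (fun l => r (tagnat.Rank i l)) l m) :> nat.
Proof.
rewrite [LHS]tagnat.RankEsum [RHS]tagnat.RankEsum.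
rewrite [X in _ = (_ + X)%N]tagnat.RankEsum addnA; congr (_ + _)%N.
rewrite (reindex (@tagnat.rank _ j)) /=; last exact/onW_bij/tagnat.rank_bij.
transitivity (\sum_i' \sum_(l' : 'I_(j i') |
    (tagnat.Rank i' l' < tagnat.Rank i l)%N) r (tagnat.Rank i' l'))%N.
  by rewrite sig_big_dep /=; apply: eq_big => -[].
rewrite (bigID (fun i' : 'I_k => (i' < i)%N)) /=; congr (_ + _)%N.
  apply: eq_bigr => i' lt_i /=; apply: eq_bigl => l'.
  by rewrite lt_Rank lt_i.
rewrite -[RHS]addn0 (bigD1 i) ?ltnn //; apply: (congr2 addn).
  by apply: eq_bigl => l'; rewrite lt_Rank ltnn eqxx.
apply: big1 => i' /andP[/negPf ge_i /negPf ne_i]; apply: big_pred0 => l'.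
by rewrite lt_Rank ge_i ne_i.
Qed.

Lemma lcoset_stab (gT : finGroupType) (h c : gT) (K : {group gT}) :
  (h *: (c *: K) == c *: K) = (h \in K :^ c^-1).
Proof.
rewrite mem_conjgV conjgE -lcoset_id_eq !lcosetM.
by rewrite -[in RHS](inj_eq (@lcoset_inj _ c)) lcosetKV.
Qed.

(** * The operad of trees of a transfer system *)

Section Realization.
Variables (gT : finGroupType) (R : {group gT} -> {group gT} -> Prop).
Hypothesis R_ts : transfer_system R.
Implicit Types (K H L : {group gT}).

(* A letter (b, K, H, x K) is an input edge of the node (K, H, x H); the
   boolean only serves to provide a node with two fixed inputs. *)
Definition letter : eqType :=
  (bool * {group gT} * {group gT} * {set gT})%type.

Implicit Types (a b : letter) (u v w : seq letter).

(** For each boolean, the edges x K of the node x H form a transitive set under its stabilizer, the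
    conjugate of [H] by x. *)
Definition node a := let: (_, K, H, C) := a in (K, H, C * H).

Definition letter_act (g : gT) a : letter := let: (b, K, H, C) := a in (b, K, H, g *: C).

Definition letter_ok a : Prop :=
  let: (_, K, H, C) := a in R K H /\ C \in lcosets K [set: gT].

(** Neither path is a prefix of the other, and the first letters that differ enter the same node. *)
Fixpoint diverge u v : bool :=
  match u, v with
  | a :: u', b :: v' => if a == b then diverge u' v' else node a == node b
  | _, _ => false
  end.

Lemma letter_act1 a : letter_act 1 a = a.
Proof. by case: a => [[[b K] H] C]; rewrite /= lcoset1. Qed.

Lemma letter_actM g h a : letter_act (g * h) a = letter_act g (letter_act h a).
Proof. by case: a => [[[b K] H] C]; rewrite /= lcosetM. Qed.

Lemma letter_act_inj g : injective (letter_act g).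
Proof.
by move=> a b E; rewrite -[a]letter_act1 -[b]letter_act1 -(mulVg g) !letter_actM E.
Qed.

Lemma letter_act_ok g a : letter_ok a -> letter_ok (letter_act g a).
Proof.
case: a => [[[b K] H] C] [KH /lcosetsP[x _ ->]]; split=> //.
by apply/lcosetsP; exists (g * x); rewrite ?inE ?lcosetM.
Qed.

Lemma node_act g a b : (node (letter_act g a) == node (letter_act g b)) =
  (node a == node b).
Proof.
case: a b => [[[a1 a2] a3] C] [[[b1 b2] b3] D] /=.
rewrite !xpair_eqE -!mulgA; congr (_ && _).
by apply/eqP/eqP => [/lcoset_inj|->].
Qed.

Lemma diverge_act g u v :
  diverge (map (letter_act g) u) (map (letter_act g) v) = diverge u v.
Proof.
elim: u v => [|a u IH] [|b v] //=.
by rewrite IH node_act (inj_eq (@letter_act_inj g)).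
Qed.

Lemma diverge_irr u : diverge u u = false.
Proof. by elim: u => //= a u; rewrite eqxx. Qed.

Lemma diverge_catl w u v : diverge (w ++ u) (w ++ v) = diverge u v.
Proof. by elim: w => //= a w IH; rewrite eqxx. Qed.

Lemma diverge_catr u v u' v' : diverge u v -> diverge (u ++ u') (v ++ v').
Proof. by elim: u v => [|a u IH] [|b v] //=; case: eqP => // _; apply: IH. Qed.

Lemma diverge_node w a b u v :
  diverge (w ++ a :: u) (w ++ b :: v) -> node a = node b.
Proof. by rewrite diverge_catl /=; case: eqP => [-> //|_ /eqP]. Qed.

(* The leaves of a tree, encoded by their paths from the root; two distinct
   paths separate at a node. *)
Definition leaves n (x : 'I_n -> seq letter) : Prop :=
  (forall i a, a \in x i -> letter_ok a) /\
  (forall i j, i != j -> diverge (x i) (x j)).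

Definition tree n : Type := {x : 'I_n -> seq letter | leaves x}.

Lemma tree_ext n (x y : tree n) : sval x =1 sval y -> x = y.
Proof. by case: x y => x Hx [y Hy] /= E; apply: eq_exist; apply/funext. Qed.

Lemma tree_ext_tag m n (x : tree m) (y : tree n) : m = n ->
  (forall (i : 'I_m) (j : 'I_n), i = j :> nat -> sval x i = sval y j) ->
  existT tree m x = existT tree n y.
Proof.
move=> e; case: _ / e y => y E; congr existT; apply: tree_ext => i; exact: E.
Qed.

Definition tree_gact n (g : gT) (x : tree n) : tree n.
Proof.
exists (fun i => map (letter_act g) (sval x i)).
case: x => x [x_ok x_div] /=; split=> [i _ /mapP[a /x_ok ok ->]|i j /x_div].
  exact: letter_act_ok.
by rewrite diverge_act.
Defined.

Definition tree_sact n (x : tree n) (s : Sigma n) : tree n.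
Proof.
exists (fun i => sval x (s i)).
case: x => x [x_ok x_div] /=; split=> [i|i j ne]; first exact: x_ok.
by apply: x_div; rewrite (inj_eq (@sigma_inj _ s)).
Defined.

Definition tree_id : tree 1.
Proof. by exists (fun=> [::]); split=> // i j; rewrite !ord1 eqxx. Defined.

(** Grafting of trees, as concatenation of paths from the root. *)
Definition tree_comp k (j : 'I_k -> nat) (c : tree k) (d : forall i, tree (j i)) :
  tree (\sum_i j i)%N.
Proof.
exists (fun x => let t := tagnat.sig x in
  sval c (tag t) ++ sval (d (tag t)) (tagged t)).
split=> [x a|x y]; rewrite /=.
  rewrite mem_cat => /orP[]; first by case: (svalP c) => + _; apply.
  by case: (svalP (d (tag (tagnat.sig x)))) => + _; apply.
rewrite -(can_eq (@tagnat.sigK _ _)).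
case: (tagnat.sig x) (tagnat.sig y) => i l [i' l'] /=.
have [ii'|ne _] := eqVneq i i'; last first.
  by apply: diverge_catr; case: (svalP c) => _; apply.
case: _ / ii' l' => l'; rewrite eq_Tagged /= diverge_catl => ne.
by case: (svalP (d i)) => _; apply.
Defined.

Definition tree_seq : symseq gT.
Proof.
apply: (@SymSeq gT tree tree_gact tree_sact).
- by move=> n x; apply: tree_ext => i /=; rewrite (eq_map letter_act1) map_id.
- move=> n g h x; apply: tree_ext => i /=.
  by rewrite (eq_map (letter_actM g h)) map_comp.
- by move=> n x; apply: tree_ext => i /=; rewrite sigma_app1.
- by move=> n x s t; apply: tree_ext => i /=; rewrite sigma_appM.
- by move=> n g x s; apply: tree_ext.
Defined.

Definition tree_op : operad gT.
Proof.
apply: (@Operad gT tree_seq tree_id tree_comp).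
- move=> n d; apply: tree_ext_tag; first by rewrite big_ord1.
  move=> x y xy /=; congr (sval d _); apply: val_inj; rewrite /= -xy.
  rewrite [in RHS](tagnat.rect x) /tagnat.sig2 /tagnat.sig1 big_pred0 // => i.
  by rewrite !ord1.
- move=> n c; apply: tree_ext_tag; first by rewrite sum1_card card_ord.
  move=> x y xy /=; rewrite cats0; congr (sval c _); apply: val_inj; rewrite /= -xy.
  rewrite [in RHS](tagnat.rect x) /tagnat.sig2 ord1 addn0.
  by rewrite (big_ord_narrow (ltnW (ltn_ord (tagnat.sig1 x)))) sum1_card card_ord.
- move=> k j c d r e; apply: tree_ext_tag; first exact: sum_blocks.
  move=> x y xy /=.
  move: xy; rewrite -[y]tagnat.sigK; case: (tagnat.sig y) => i z.
  rewrite -[z]tagnat.sigK; case: (tagnat.sig z) => l m {y z} xy.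
  have -> : x = tagnat.Rank (tagnat.Rank i l) m.
    apply: val_inj; apply: etrans xy _; apply: esym; exact: Rank_Rank.
  by rewrite /tagnat.Rank !tagnat.rankK /= catA.
- move=> k j c d s; apply: tree_ext_tag; first by rewrite -sum_perm.
  move=> x y xy; rewrite /= /block_perm sigma_permE /block_perm_fun.
  rewrite (_ : cast_ord _ _ = x); last exact/val_inj/esym.
  by rewrite /tagnat.Rank tagnat.rankK.
- move=> k j c d t; apply: tree_ext => x.
  by rewrite /= /block_sum sigma_permE /block_sum_fun /tagnat.Rank tagnat.rankK.
- by move=> g; apply: tree_ext.
- by move=> g k j c d; apply: tree_ext => x; rewrite /= map_cat.
Defined.

(** Two inputs of the node G/G, both fixed by G; they form the binary mark. *)
Definition fixed_letter (t : bool) : letter :=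
  (t, [group of [set: gT]], [group of [set: gT]], [set: gT]).

Lemma fixed_letter_ok t : letter_ok (fixed_letter t).
Proof.
split; first exact: (ts_refl R_ts).
by apply/lcosetsP; exists 1; rewrite ?lcoset1 ?inE.
Qed.

Lemma fixed_letter_act g t : letter_act g (fixed_letter t) = fixed_letter t.
Proof. by congr pair; apply: (@lcoset_id _ [group of [set: gT]]); rewrite inE. Qed.

Definition tree_mark0 : tree 0.
Proof. by exists (fun=> [::]); split=> -[]. Defined.

Definition tree_mark2 : tree 2.
Proof.
exists (fun i => [:: fixed_letter (i == ord0)]); split=> [i a|i j ne].
  rewrite inE => /eqP ->; exact: fixed_letter_ok.
rewrite /= /fixed_letter !xpair_eqE !eqxx !andbT.
by case: i j ne => [[|[|i]] Hi] [[|[|j]] Hj].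
Defined.

Definition tree_moperad : moperad gT.
Proof.
apply: (@MOperad gT tree_op tree_mark0 tree_mark2).
- by move=> g; apply: tree_ext => -[].
- by move=> g; apply: tree_ext => i; congr [:: _]; apply: fixed_letter_act.
Defined.

Lemma wstab_group_set H u :
  group_set [set h in H | map (letter_act h) u == u].
Proof.
apply/group_setP; split.
  by rewrite inE group1 (eq_map letter_act1) map_id eqxx.
move=> g h; rewrite !inE => /andP[Hg /eqP gu] /andP[Hh /eqP hu].
by rewrite groupM //= (eq_map (letter_actM g h)) map_comp hu gu.
Qed.

Definition wstab H u : {group gT} := Group (wstab_group_set H u).

(* Along the path x i, the stabilizer of the edge at the end of w fixes the next
   node, hence lies in a conjugate of H1, where K1 -> H1 can be restricted. *)
Lemma wstab_admissible n (x : tree n) H (s : gT -> Sigma n) i w v :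
  (forall h, h \in H -> gact h (x : tree_seq n) = sact (x : tree_seq n) (s h)) ->
  sval x i = w ++ v -> R (wstab H w) H.
Proof.
move=> xP; elim/last_ind: w v => [|w a IH] v xE.
  rewrite (_ : wstab H [::] = H); first exact: (ts_refl R_ts).
  by apply: group_inj; apply/setP => h; rewrite inE eqxx andbT.
rewrite cat_rcons in xE; have {IH} R1 := IH _ xE; apply: (ts_trans R_ts) R1.
have [x_ok x_div] := svalP x.
have := x_ok i a; rewrite xE mem_cat inE eqxx orbT => /(_ isT).
(* The path of leaf [s h i] is [w] followed by the translate of [a]. Either this is leaf [i] again
   and [a] is fixed, or the two paths diverge, which forces a common node. *)
have node_fix h : h \in wstab H w -> node (letter_act h a) = node a.
  rewrite inE => /andP[Hh /eqP hw].
  have : sval x (s h i) = w ++ letter_act h a :: map (letter_act h) v.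
    by rewrite -hw -map_cons -map_cat -xE -[RHS]/(sval (gact h (x : tree_seq n)) i) xP.
  have [-> |ne E] := eqVneq (s h i) i.
    by rewrite xE => /eqP; rewrite eqseq_cat // eqseq_cons => /and3P[_ /eqP <-].
  by have := x_div _ _ ne; rewrite xE E => /diverge_node.
case: a xE node_fix => [[[b K1] H1] C] xE node_fix [KH1 /lcosetsP[c _ CE]].
have sub : wstab H w \subset H1 :^ c^-1.
  apply/subsetP => h /node_fix[]; rewrite CE -!mulgA.
  have -> : (K1 * H1 = H1)%g by rewrite mulSGid // (ts_sub R_ts).
  by move=> /eqP; rewrite lcoset_stab.
rewrite (_ : wstab H _ = wstab H w :&: K1 :^ c^-1)%G; last first.
  apply: group_inj; apply/setP => h; rewrite !inE map_rcons eqseq_rcons /=.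
  rewrite -andbA; do 2!congr (_ && _).
  by rewrite !xpair_eqE !eqxx /= CE lcoset_stab.
exact: (ts_restr R_ts (ts_conj R_ts c KH1) sub).
Qed.

(** Distinct leaves have distinct paths, so the leaf indexed by the coset [K] has stabilizer [K],
    and [wstab_admissible] applies to its whole path. Conversely, [R K H] allows a corolla with
    leaves H/K. *)
Lemma transfer_tree K H : transfer tree_moperad K H <-> R K H.
Proof.
split=> [[sKH [x /fixed_graphP xP]]|KH].
  have /imsetP[i _ iE] : (K : {set gT}) \in
      (fun i : 'I_#|H : K| => nth_coset K H i) @: [set: 'I_#|H : K|].
    by rewrite nth_coset_im; apply/lcosetsP; exists 1; rewrite ?lcoset1.
  have := wstab_admissible (i := i) xP (esym (cats0 _)).
  rewrite (_ : wstab H _ = K) //; apply: group_inj; apply/setP => h.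
  rewrite inE; have [Hh|nHh] := boolP (h \in H); last first.
    by apply/esym/negbTE; apply: contra nHh; apply: subsetP.
  have -> : map (letter_act h) (sval x i) = sval x (coset_perm K H h i).
    by rewrite -[LHS]/(sval (gact h (x : tree_seq _)) i) xP.
  have -> : (h \in K) = (coset_perm K H h i == i).
    rewrite -(inj_eq (@nth_coset_inj _ K H)) coset_permP //.
    by move: (nth_coset K H i) iE => _ <-; rewrite lcoset_id_eq.
  have [->|ne] := eqVneq (coset_perm K H h i) i; first by rewrite !eqxx.
  by apply/negP => /eqP E; have := (svalP x).2 _ _ ne; rewrite E diverge_irr.
have sKH := ts_sub R_ts KH; split=> //.
(* All edges enter the node of the coset [H]; the boolean is fixed so that they are permuted as
   H/K. *)
pose x i : seq letter := [:: (true, K, H, nth_coset K H i)].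
have nthP (i : 'I_#|H : K|) : nth_coset K H i \in lcosets K H.
  by rewrite -nth_coset_im; apply: (imset_f (fun i : 'I_#|H : K| => nth_coset K H i)).
have xP : leaves (fun i : 'I_#|H : K| => x i).
  split=> [i a|i j ne].
    rewrite inE => /eqP ->; split=> //.
    by have /lcosetsP[c _ ->] := nthP i; apply/lcosetsP; exists c; rewrite ?inE.
  rewrite /= !xpair_eqE !eqxx /= (inj_eq (@nth_coset_inj _ K H)) (negPf ne).
  have /lcosetsP[c Hc ->] := nthP i; have /lcosetsP[c' Hc' ->] := nthP j.
  by rewrite -!mulgA mulSGid // !lcoset_id.
exists (exist _ _ xP : tree_seq _); apply/fixed_graphP => h Hh.
by apply: tree_ext => i; rewrite /= /x coset_permP.
Qed.
End Realization.

(** * Maps out of cofibrant operads *)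

Lemma mophom_transfer gT (O P : moperad gT) (k : mophom O P) :
  subrel_on (transfer O) (transfer P).
Proof.
move=> K H [sKH [x xP]]; split=> //; exists (k _ x) => a Ha.
by rewrite -symhom_gsact xP.
Qed.

Lemma weak_equiv_transfer gT (O P : moperad gT) (q : mophom O P) :
  weak_equiv q -> subrel_on (transfer P) (transfer O).
Proof.
by move=> wq K H [sKH PK]; split=> //; apply: wq PK; apply: coset_graph_subgroup.
Qed.

Section Product.
Variables (gT : finGroupType) (O P : moperad gT).

Definition prod_seq : symseq gT.
Proof.
apply: (@SymSeq gT (fun n => (O n * P n)%type)
  (fun n g x => (gact g x.1, gact g x.2)) (fun n x s => (sact x.1 s, sact x.2 s))).
- by move=> n [x y] /=; rewrite !gact1.
- by move=> n g h [x y] /=; rewrite !gactM.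
- by move=> n [x y] /=; rewrite !sact1.
- by move=> n [x y] s t /=; rewrite !sactM.
- by move=> n g [x y] s /=; rewrite !gsactC.
Defined.

Lemma prod_ext_tag m n (x : prod_seq m) (y : prod_seq n) :
  tagop O x.1 = tagop O y.1 -> tagop P x.2 = tagop P y.2 ->
  tagop prod_seq x = tagop prod_seq y.
Proof.
move=> E; have e : m = n := congr1 (@projT1 _ _) E; subst n.
case: x y E => [x1 x2] [y1 y2] /= /tagop_inj -> /tagop_inj -> //.
Qed.

Definition prod_op : operad gT.
Proof.
apply: (@Operad gT prod_seq (opid O, opid P)
  (fun k j c d => (opcomp c.1 (fun i => (d i).1), opcomp c.2 (fun i => (d i).2)))).
- by move=> n d; apply: prod_ext_tag; apply: opcomp_idl.
- by move=> n c; apply: prod_ext_tag; apply: opcomp_idr.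
- by move=> k j c d r e; apply: prod_ext_tag; apply: opcompA.
- move=> k j c d s; apply: prod_ext_tag.
    exact: (opcomp_perm c.1 (fun i => (d i).1)).
  exact: (opcomp_perm c.2 (fun i => (d i).2)).
- by move=> k j c d t; rewrite /= !opcomp_sum.
- by move=> g; rewrite /= !gact_opid.
- by move=> g k j c d; rewrite /= !gact_opcomp.
Defined.

Definition prod_moperad : moperad gT.
Proof.
apply: (@MOperad gT prod_op (mark0 O, mark0 P) (mark2 O, mark2 P)).
- by move=> g; rewrite /= !gact_mark0.
- by move=> g; rewrite /= !gact_mark2.
Defined.

Definition prod_fst : mophom prod_moperad O.
Proof.
by unshelve refine (@MOpHom gT prod_moperad O
  (@SymHom gT prod_moperad O (fun n x => x.1) _ _) _ _ _ _).
Defined.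

Definition prod_snd : mophom prod_moperad P.
Proof.
by unshelve refine (@MOpHom gT prod_moperad P
  (@SymHom gT prod_moperad P (fun n x => x.2) _ _) _ _ _ _).
Defined.

(** A map out of the free operad on an orbit is a fixed operation [x] of [O]; pairing it with a
    fixed operation of [P] gives the lift. *)
Lemma prod_fst_acyc_fibration :
  (forall n (Gam : {set gT * Sigma n}), graph_subgroup Gam ->
     has_fixed O Gam -> has_fixed P Gam) ->
  acyc_fibration prod_fst.
Proof.
move=> OP A B i [n [Gam [GamP [etaA [etaB [A_free B_free iE]]]]]] a b sq.
pose x := b n (etaB n (orbit_base Gam)).
have xP : fixed Gam x.
  by move=> c Gc; rewrite -!symhom_gsact orbit_base_fixed.
have [y yP] := OP n Gam GamP (ex_intro _ x xP).
have xyP : fixed Gam ((x, y) : prod_moperad n).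
  by move=> c Gc; congr pair; [apply: xP | apply: yP].
have [h hE] := orbit_map GamP xyP.
have [l [lE _]] := B_free prod_moperad h.
exists l; split=> m z.
  by apply: (free_uniq A_free (k := comp_mophom l i) (k' := a)) => ? [].
apply: (free_uniq B_free (k := comp_mophom prod_fst l) (k' := b)) => {}m {}z.
move: m z; apply: orbit_seq_ind => c.
by rewrite !symhom_gsact [comp_mophom _ _ _ _]/= lE hE.
Qed.
End Product.

Lemma mophom_refl gT (O : moperad gT) :
  exists k : mophom O O, forall n (x : O n), k n x = x.
Proof.
unshelve eexists.
  by unshelve refine (@MOpHom gT O O (@SymHom gT O O (fun _ x => x) _ _) _ _ _ _).
by [].
Qed.

(** By [admissibleP], fixed points of any graph subgroup are detected on orbits, hence by the
    transfer relation. Lifting the identity of [Q] gives a section of the first projection, to be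
    followed by the second. *)
Lemma cofibrant_map gT (Q M : moperad gT) :
  cofibrant Q -> subrel_on (transfer Q) (transfer M) -> inhabited (mophom Q M).
Proof.
case=> A [i [A_init i_cof]] QM.
have p_acyc : acyc_fibration (prod_fst Q M).
  apply: prod_fst_acyc_fibration => n _ [H [s ->]] /has_fixed_graphP adm.
  have gD := gset_graph s.
  apply/has_fixed_graphP/(admissibleP _ gD) => t tD K KE.
  exact/QM/(proj1 (admissibleP _ gD) adm t).
have [a _] := A_init (prod_moperad Q M).
have [b bE] := mophom_refl Q.
have [l _] := i_cof _ _ _ p_acyc a b (fun n x =>
  initial_uniq (comp_mophom (prod_fst Q M) a) (comp_mophom b i) A_init x).
by split; exact: (comp_mophom (prod_snd Q M) l).
Qed.

(** * Restriction and coinduction *)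

Section Functoriality.
Variables (gT gT' : finGroupType) (f : {morphism [set: gT] >-> gT'}).

Lemma admissible_res (O : moperad gT') (H : {group gT}) (T : finType) act
    (D : {set T}) :
  admissible (res f O) H (fun h => act (f h)) D <-> admissible O (f @* H) act D.
Proof.
split=> -[[n [e x]] [e_inj eD xP]].
  exists (labelled e (x : O n)); split=> // _ phi /morphimP[h _ Hh ->].
  exact: xP.
exists (labelled e (x : res f O n)); split=> // h phi Hh.
by apply: xP; rewrite mem_morphim ?inE.
Qed.

Lemma gset_morphim (H : {group gT}) (T : finType) act (D : {set T}) :
  gset (f @* H)%G act D -> gset H (fun h => act (f h)) D.
Proof.
have fH h : h \in H -> f h \in (f @* H)%g by move=> Hh; rewrite mem_morphim ?inE.
case=> a1 aM aD; split=> [t|g h Hg Hh t|h t Hh]; first by rewrite morph1.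
  by rewrite morphM ?inE // aM ?fH.
by apply: aD; apply: fH.
Qed.

(** Through [f], the group [f @*^-1 H] acts on H/K, and the coset [K] has stabilizer [f @*^-1 K]. *)
Lemma transfer_res_preim (O : moperad gT') (K H : {group gT'}) :
  transfer O K H -> transfer (res f O) (f @*^-1 K)%G (f @*^-1 H)%G.
Proof.
case=> sKH /admissible_cosetP adm.
have sfH : (f @* (f @*^-1 H))%G \subset H by rewrite sub_morphim_pre ?subsetT.
have gD := gset_morphim (gsetS sfH (gset_lcosets H K)).
apply: (proj1 (admissibleP _ gD) _ K).
- exact/admissible_res/(admissibleS sfH).
- by apply/lcosetsP; exists 1; rewrite ?group1 ?lcoset1.
- apply/setP => h; rewrite !inE /coset_act lcoset_id_eq /=.
  by rewrite andb_idl // => /(subsetP sKH).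
Qed.

(** For injective [f], taking images of cosets identifies H/K with the orbit of f(H) by f(K). *)
Lemma transfer_res_inj (O : moperad gT') (K H : {group gT}) : 'injm f ->
  transfer (res f O) K H <-> transfer O (f @* K)%G (f @* H)%G.
Proof.
move=> f_inj; rewrite /transfer -!admissible_cosetP -admissible_res.
have -> : ((f @* K)%G \subset (f @* H)%G) = (K \subset H).
  by rewrite injmSK ?subsetT.
suff E : admissible (res f O) H coset_act (lcosets K H) <->
    admissible (res f O) H (fun h => coset_act (f h)) (lcosets (f @* K)%G (f @* H)%G).
  by rewrite E.
have fE x : (f @* (x *: K) = f x *: (f @* K))%g.
  by rewrite morphimMl ?subsetT ?morphim_set1 ?inE.
apply: (@admissible_iso _ _ _ _ _ _ _ _ _ (fun C => f @* C)%g).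
- by case: (gset_lcosets H K).
- by move=> C C' _ _ /(injm_morphim_inj f_inj); apply; apply: subsetT.
- apply/setP => C; apply/imsetP/lcosetsP.
    case=> _ /lcosetsP[x Hx ->] ->; exists (f x); first by rewrite mem_morphim ?inE.
    exact: fE.
  case=> _ /morphimP[x _ Hx ->] ->; exists (x *: K); first by apply/lcosetsP; exists x.
  by rewrite fE.
- move=> h _ Hh /lcosetsP[x Hx ->].
  by rewrite /coset_act -lcosetM !fE morphM ?inE // lcosetM.
Qed.

(** A fixed point is a function [y] from G' to [O n] with [y (f g * a) = gact g (y a)] and
    [y (a * h) = sact (y a) (s h)]. It is built from one value on each double coset of f(G) and
    [H]. *)
Lemma transfer_coind (O : moperad gT) (K H : {group gT'}) :
  K \subset H ->
  (forall a, transfer O (f @*^-1 (K :^ a^-1))%G (f @*^-1 (H :^ a^-1))%G) ->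
  transfer (coind f O) K H.
Proof.
move=> sKH tr; split=> //.
set n := #|H : K|; pose s : gT' -> Sigma n := coset_perm K H.
(* The compatibility required of the value at a representative [r], coming from the elements [g]
   with [f g * r = r * h] for some [h] in [H]. *)
have adm r : exists x : O n, forall g, f g \in H :^ r^-1 ->
    gact g x = sact x (s (f g ^ r)).
  pose L := (f @*^-1 (H :^ r^-1))%G.
  have LE g : (g \in L) = (f g ^ r \in H) by rewrite !inE mem_conjgV.
  pose act g := coset_act (f g ^ r).
  have gD : gset L act (lcosets K H).
    split=> [C|g h _ _ C|g C]; rewrite /act /coset_act.
    - by rewrite morph1 conj1g lcoset1.
    - by rewrite morphM ?inE // conjMg lcosetM.
    - by rewrite LE => Hg CH; case: (gset_lcosets H K) => _ _; apply.
  have : admissible O L act (lcosets K H).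
    apply/(admissibleP _ gD) => _ /lcosetsP[h Hh ->] M ME.
    (* The stabilizer of [h *: K] and [L] itself are both preimages of conjugates by [r * h], since
       [h] normalizes [H]; this is [tr] at [r * h]. *)
    rewrite (_ : M = f @*^-1 (K :^ (r * h)^-1))%G; last first.
      apply: group_inj; rewrite ME; apply/setP => g.
      rewrite inE LE /act /coset_act lcoset_stab !inE /= invMg conjsgM.
      rewrite !mem_conjgV andb_idl // => /(subsetP sKH).
      by rewrite groupJr.
    rewrite (_ : L = f @*^-1 (H :^ (r * h)^-1))%G; first exact: tr.
    apply: group_inj; congr (f @*^-1 _)%g; rewrite /= invMg conjsgM.
    by rewrite (conjGid (groupVr Hh)).
  move=> /(admissible_label (@nth_coset_inj _ K H) (nth_coset_im K H))[x [_ _ xP]].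
  exists x => g Hg.
  have Hgr : f g ^ r \in H by rewrite -mem_conjgV.
  have Lg : g \in L by rewrite LE.
  have /relabP[t -> E] := xP g (s (f g ^ r)) Lg (coset_permP Hgr).
  by congr sact; apply/sigma_ext => i; rewrite -E.
have /choice[x xP] := adm.
have sM : {in H &, forall h h', s (h * h') = s h * s h'} := @coset_permM _ K H.
(* As [repr] depends only on the set, [rep] is constant on each double coset. *)
pose F := (f @* [set: gT])%G; pose dc b := (F :* b * H)%g; pose rep b := repr (dc b).
have repM g b h : h \in H -> rep (f g * b * h) = rep b.
  move=> Hh; rewrite /rep /dc !rcosetM (rcoset_id (mem_morphim _ _ _)) ?inE //.
  by congr (repr _); rewrite -[LHS]mulgA lcoset_id.
have repP b : exists gh : gT * gT', gh.2 \in H /\ b = f gh.1 * rep b * gh.2.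
  have : rep b \in dc b.
    by apply: (mem_repr b); have := mem_mulg (rcoset_refl F b) (group1 H); rewrite mulg1.
  case/mulsgP=> _ h /rcosetP[_ /morphimP[g _ _ ->] ->] Hh ->.
  exists (g^-1, h^-1); rewrite groupV; split=> //=.
  by rewrite morphV ?inE // !mulgA mulVg mul1g mulgK.
have /choice[gh ghP] := repP.
pose y b := gact (gh b).1 (sact (x (rep b)) (s (gh b).2)).
(* Two decompositions of [b] differ by some [g] with [f g ^ rep b] in [H], so [xP] makes the value
   independent of the choice. *)
have yE g b h : h \in H -> b = f g * rep b * h ->
    y b = gact g (sact (x (rep b)) (s h)).
  move=> Hh bE; have [Hh' bE'] := ghP b.
  rewrite /y; move: (gh b) Hh' bE' => [g' h'] /= Hh' bE'.
  have uE : f (g'^-1 * g) ^ rep b = h' * h^-1.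
    rewrite morphM ?morphV ?inE // conjgE.
    apply: (mulIg h); rewrite mulgKV; apply: (mulgI (f g' * rep b)).
    rewrite -bE'; apply: etrans _ (esym bE).
    by rewrite !mulgA mulgK mulgV mul1g.
  rewrite -[in RHS](mulKVg g' g) gactM; congr gact; rewrite gsactC xP.
    by rewrite uE -sactM -sM ?groupM ?groupV // mulgKV.
  by rewrite mem_conjgV uE groupM ?groupV.
have y_equiv g a : y (f g * a) = gact g (y a).
  have [Hh aE] := ghP a; rewrite [y a]/y.
  have rE : rep (f g * a) = rep a by rewrite -[f g * a]mulg1 repM.
  rewrite (yE (g * (gh a).1) _ (gh a).2) ?rE ?gactM //.
  by rewrite {1}aE morphM ?inE // !mulgA.
pose z : coind f O n := exist _ y y_equiv.
exists z; apply/fixed_graphP => h Hh; apply: coind_ext => a /=.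
have [Hh' aE] := ghP a; rewrite [y a]/y.
have rE : rep (a * h) = rep a by have := repM 1 a h Hh; rewrite morph1 mul1g.
rewrite (yE (gh a).1 _ ((gh a).2 * h)) ?groupM ?rE //; last by rewrite {1}aE !mulgA.
by rewrite sM // sactM gsactC.
Qed.
End Functoriality.

(** * Transfer systems of the derived functors *)

Theorem theoremB (gT gT' : finGroupType) (f : {morphism [set: gT] >-> gT'}) :
  [/\ forall (O' : moperad gT') (P : moperad gT),
        is_Lres f O' P -> is_finvL f (transfer O') (transfer P),
      forall (O : moperad gT) (P : moperad gT'),
        is_Rcoind f O P -> is_fR f (transfer O) (transfer P)
    & ('injm f)%g -> forall (O : moperad gT) (P : moperad gT'),
        is_Lind f O P -> is_fL f (transfer O) (transfer P)].
Proof.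
split.
- move=> O' _ [Q [q [[Q_cof q_we] ->]]].
  split; first exact: transfer_is_transfer_system.
    move=> _ _ [K [H [KH -> ->]]].
    exact/transfer_res_preim/(weak_equiv_transfer q_we).
  move=> T T_ts XT.
  (* The criterion for [coind] involves all conjugates of [K] and [H]; they are again transfers of
     [O'], so [T] contains their preimages. *)
  have [|k] := @cofibrant_map _ Q (coind f (tree_moperad T_ts)) Q_cof.
    move=> K H QKH; apply: transfer_coind => [|a]; first by case: QKH.
    apply/transfer_tree/XT; exists (K :^ a^-1)%G, (H :^ a^-1)%G; split=> //.
    exact/transfer_conj/(mophom_transfer q).
  (* The adjoint of [k], from [res f Q] to the tree operad of [T]. *)
  move=> K H /(mophom_transfer (comp_mophom (coind_counit f _) (res_hom f k))).
  by move/transfer_tree.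
- move=> O P [R [r [eps [[_ r_we] epsP]]]].
  split; first exact: transfer_is_transfer_system.
    move=> K H KH; split; first by case: KH.
    apply: (weak_equiv_transfer r_we); apply: (mophom_transfer eps).
    exact: transfer_res_preim.
  move=> T T_ts TX K H TKH.
  (* The universal property of [P] receives the explicit coinduction, where fixed points can be
     constructed. *)
  have [k _] := epsP _ (coind_counit f R).
  apply: (mophom_transfer k); apply: transfer_coind => [|a].
    exact: (ts_sub T_ts).
  have [_] := TX _ _ (ts_conj T_ts a TKH).
  exact: (mophom_transfer r).
- move=> f_inj O P [Q [q [eta [[Q_cof q_we] etaP]]]].
  split; first exact: transfer_is_transfer_system.
    move=> _ _ [K [H [KH -> ->]]].
    apply/(transfer_res_inj _ _ _ f_inj)/(mophom_transfer eta).
    exact: (weak_equiv_transfer q_we).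
  move=> T T_ts XT.
  (* For injective [f], the transfers of the restricted tree operad are the pairs whose images lie
     in [T]; the adjoint of [h] then maps [P] to the tree operad. *)
  have [|h] := @cofibrant_map _ Q (res f (tree_moperad T_ts)) Q_cof.
    move=> K H QKH; apply/(transfer_res_inj _ _ _ f_inj)/transfer_tree/XT.
    by exists K, H; split=> //; apply: (mophom_transfer q).
  have [k _] := etaP _ h.
  by move=> K H /(mophom_transfer k)/transfer_tree.
Qed.
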